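(* Let $\{\mathcal R(t)\}_{t\ge 0}$ be the resolvent family of the Volterra equation $X(t)=\int_0^t a(t-\tau)AX(\tau)\,d\tau+X_0+Z(t)$ and let $Z$ be an $H$-valued Lévy process. Fix $t>0$. For $n\in\mathbb N$ let $0=t_0<t_1<\dots<t_n=t$ be partitions of $[0,t]$ with mesh tending to $0$, choose points $s_i\in[t_{i-1},t_i]$, and put $\mathcal R_n:=\sum_{i=1}^n \mathcal R(s_i)\chi_{[t_{i-1},t_i]}$ (step functions on $[0,t]$). Then the integrals $\int_0^t \mathcal R_n(t-\tau)\,dZ(\tau)$ (defined as the corresponding finite sums of the form $\sum_k \Phi_n^k(Z(r_{k+1})-Z(r_k))$) converge in probability, the limit $$\int_0^t \mathcal R(t-\tau)\,dZ(\tau):=P\text{-}\lim_{n\to\infty}\int_0^t \mathcal R_n(t-\tau)\,dZ(\tau)$$ does not depend on the choice of the approximating sequence, and it is a well-defined $H$-valued random variable with an infinitely divisible distribution.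
   Context: $H$ is a real separable Hilbert space with inner product $\langle\cdot,\cdot\rangle_H$ and norm $|\cdot|_H$; $L(H)$ denotes bounded linear operators on $H$. $A$ is a closed linear operator in $H$ with dense domain $\mathcal D(A)$, and $a\in L^1_{\mathrm{loc}}(\mathbb R_+)$. The equation is assumed well-posed, with resolvent family $\{\mathcal R(t)\}_{t\ge0}\subset L(H)$: $\mathcal R(t)$ is uniformly bounded on compact intervals, strongly continuous in $t$, $\mathcal R(0)=I$, and the resolvent equation $\mathcal R(t)x=x+\int_0^t a(t-\tau)A\mathcal R(\tau)x\,d\tau$ holds for all $x\in\mathcal D(A)$, $t\ge0$. $(\Omega,\mathcal F,(\mathcal F_t),P)$ is a filtered probability space; an $H$-valued Lévy process $Z$ is an $(\mathcal F_t)$-adapted process with independent and stationary (homogeneous) increments, continuous in probability, with càdlàg paths and $Z(0)=0$. For a step function $\Phi=\sum_{k}\Phi^k\chi_{(r_k,r_{k+1}]}$ with $\Phi^k\in L(H)$, $\int\Phi\,dZ:=\sum_k\Phi^k(Z(r_{k+1})-Z(r_k))$. *)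

(* Defs.v *)
From HB Require Import structures.
From mathcomp Require Import all_boot all_order all_algebra.
From mathcomp Require Import all_classical all_reals all_analysis.
Set Implicit Arguments. Unset Strict Implicit. Unset Printing Implicit Defensive.
Import Order.TTheory GRing.Theory Num.Theory.
Import numFieldNormedType.Exports.
Local Open Scope classical_set_scope.
Local Open Scope ring_scope.

Section defs.
Context {R : realType}.

Definition is_inner_product (H : normedModType R) (ip : H -> H -> R) : Prop :=
  [/\ forall x y, ip x y = ip y x,
      forall (c : R) x y z, ip (c *: x + y) z = c * ip x z + ip y z &
      forall x, ip x x = `|x| ^+ 2].

Definition sep_hilbert (H : completeNormedModType R) (ip : H -> H -> R) : Prop :=
  is_inner_product ip /\ exists u : nat -> H, dense (range u).

Definition linear_op (H : normedModType R) (T : H -> H) : Prop :=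
  forall (c : R) x y, T (c *: x + y) = c *: T x + T y.

Definition bounded_op (H : normedModType R) (T : H -> H) : Prop :=
  linear_op T /\ exists M : R, forall x, `|T x| <= M * `|x|.

Definition closed_dense_op (H : normedModType R) (D : set H) (A : H -> H) : Prop :=
  [/\ D 0, (forall (c : R) x y, D x -> D y -> D (c *: x + y)),
      (forall (c : R) x y, D x -> D y -> A (c *: x + y) = c *: A x + A y),
      dense D &
      closed [set q : H * H | D q.1 /\ q.2 = A q.1]].

Definition loc_integrable_Rplus (a : R -> R) : Prop :=
  forall T : R, 0 <= T ->
    (@lebesgue_measure R).-integrable `[0, T] (fun x => (a x)%:E).

(* {Rs t}_{t >= 0} is the resolvent family of the Volterra equation
   X(t) = int_0^t a(t-tau) A X(tau) dtau + X0 + Z(t).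
   The H-valued integral in the resolvent equation is taken in the weak
   sense (tested against every y in H). *)
Definition resolvent_family (H : normedModType R) (ip : H -> H -> R)
    (D : set H) (A : H -> H) (a : R -> R) (Rs : R -> H -> H) : Prop :=
  (forall t, 0 <= t -> bounded_op (Rs t)) /\
  [/\ (forall T : R, exists M : R, forall t x, 0 <= t <= T -> `|Rs t x| <= M * `|x|),
      (forall x, {within `[0, +oo[, continuous (fun t => Rs t x)}),
      (forall x, Rs 0 x = x),
      (forall x t, D x -> 0 <= t -> D (Rs t x)) &
      (forall x t y, D x -> 0 <= t ->
         (@lebesgue_measure R).-integrable `[0, t]
            (fun tau => (a (t - tau) * ip (A (Rs tau x)) y)%:E) /\
         ip (Rs t x) y = ip x y +
           fine (\int[@lebesgue_measure R]_(tau in `[0, t])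
                   (a (t - tau) * ip (A (Rs tau x)) y)%:E))].

Definition borel_sets (T : topologicalType) : set (set T) := <<s @open T >>.

Definition rv_wrt d (Om : measurableType d) (H : topologicalType)
    (G : set (set Om)) (X : Om -> H) : Prop :=
  forall B, borel_sets B -> G (X @^-1` B).

Definition rvH d (Om : measurableType d) (H : topologicalType) (X : Om -> H) : Prop :=
  rv_wrt measurable X.

Definition indep_family d (Om : measurableType d) (P : probability Om R)
    (H : topologicalType) (n : nat) (X : nat -> Om -> H) : Prop :=
  forall B : nat -> set H, (forall i, borel_sets (B i)) ->
    P (\bigcap_(i < n) (X i @^-1` B i)) = (\prod_(i < n) P (X i @^-1` B i))%E.

Definition filtration d (Om : measurableType d) (F : R -> set (set Om)) : Prop :=
  (forall t, 0 <= t -> sigma_algebra setT (F t) /\ F t `<=` measurable) /\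
  (forall s t, 0 <= s -> s <= t -> F s `<=` F t).

Definition levy_process d (Om : measurableType d) (P : probability Om R)
    (H : normedModType R) (F : R -> set (set Om)) (Z : R -> Om -> H) : Prop :=
  (forall t, 0 <= t -> rv_wrt (F t) (Z t)) /\
  [/\ (forall w, Z 0 w = 0),
      (forall (n : nat) (r : nat -> R), 0 <= r 0%N ->
         (forall k, (k < n)%N -> r k < r k.+1) ->
         indep_family P n (fun k w => Z (r k.+1) w - Z (r k) w)),
      (forall s t B, 0 <= s -> s <= t -> borel_sets B ->
         P ((fun w => Z t w - Z s w) @^-1` B) = P (Z (t - s) @^-1` B)),
      (forall s eps, 0 <= s -> 0 < eps ->
         (fun t => P [set w | eps < `|Z t w - Z s w|])
           @ within [set t | 0 <= t] (nbhs s) --> 0%E) &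
      (forall w t, 0 <= t ->
         (fun u => Z u w) @ t^'+ --> Z t w /\
         (0 < t -> exists l : H, (fun u => Z u w) @ t^'- --> l))].

Definition cvg_in_prob d (Om : measurableType d) (P : probability Om R)
    (H : normedModType R) (Y : nat -> Om -> H) (Yinf : Om -> H) : Prop :=
  forall eps : R, 0 < eps ->
    (fun n => P [set w | eps < `|Y n w - Yinf w|]) @ \oo --> 0%E.

Definition inf_divisible d (Om : measurableType d) (P : probability Om R)
    (H : normedModType R) (Y : Om -> H) : Prop :=
  forall n : nat, (0 < n)%N ->
    exists (d' : measure_display) (Om' : measurableType d')
           (P' : probability Om' R) (X : nat -> Om' -> H),
      [/\ forall i, rvH (X i),
          indep_family P' n X,
          (forall i j B, (i < n)%N -> (j < n)%N -> borel_sets B ->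
             P' (X i @^-1` B) = P' (X j @^-1` B)) &
          (forall B, borel_sets B ->
             P' ((fun w => \sum_(i < n) X i w) @^-1` B) = P (Y @^-1` B))].

(* int Phi dZ for Phi = sum_{k<m} Phi_k chi_(r_k, r_{k+1}] *)
Definition step_integral d (Om : measurableType d) (H : normedModType R)
    (Phi : nat -> H -> H) (r : nat -> R) (m : nat) (Z : R -> Om -> H)
    (w : Om) : H :=
  \sum_(k < m) Phi k (Z (r k.+1) w - Z (r k) w).

(* int_0^t R_m(t - tau) dZ(tau) with R_m = sum_{i=1}^m Rs(s_i) chi_[p_{i-1}, p_i]:
   as a step function of tau it equals Rs(s_{m-k}) on (t - p_{m-k}, t - p_{m-k-1}]. *)
Definition resolvent_step_integral d (Om : measurableType d) (H : normedModType R)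
    (Rs : R -> H -> H) (t : R) (m : nat) (p s : nat -> R) (Z : R -> Om -> H)
    (w : Om) : H :=
  step_integral (fun k => Rs (s (m - k)%N)) (fun k => t - p (m - k)%N) m Z w.

Definition mesh (m : nat) (p : nat -> R) : R :=
  \big[Num.max/0]_(i < m) (p i.+1 - p i).

Definition tagged_partitions (t : R) (m : nat -> nat) (p s : nat -> nat -> R) : Prop :=
  [/\ (forall n, p n 0%N = 0 /\ p n (m n) = t),
      (forall n i, (i < m n)%N -> p n i < p n i.+1),
      (forall n i, (0 < i)%N -> (i <= m n)%N -> p n i.-1 <= s n i <= p n i) &
      (fun n => mesh (m n) (p n)) @ \oo --> 0].

End defs.

(* Main.v *)
Require Import Defs.
From HB Require Import structures.
From mathcomp Require Import all_boot all_order all_algebra.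
From mathcomp Require Import all_classical all_reals all_analysis.
From mathcomp Require Import measurable_realfun ring lra.
Set Implicit Arguments.
Unset Strict Implicit.
Unset Printing Implicit Defensive.
Import Order.TTheory GRing.Theory Num.Theory.
Import numFieldNormedType.Exports.
Local Open Scope classical_set_scope.
Local Open Scope ring_scope.

(** The increments of [Z] are not summable, and [Rs] is only strongly
    continuous, so the proof compares [Rs] with its dyadic step approximations
    through the seminorm [osc L x], the largest oscillation of [s |-> Rs s x]
    on [[0, t]] at scale [t / 2 ^ L].  Cadlag paths have relatively compact
    range, hence [sup_(s <= t) osc L (Z s)] tends to [0] almost surely.

    If that supremum is below [del / 2] outside an event of probability at most
    [1 / 2], then for every operator [B] dominated by [osc L] the truncation
    [U] of [B (Z h)] at level [del] has mean [O(del * h)] and second moment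
    [O(del ^ 2 * h)]: apply Wald's identities to about [t / h] independent
    copies of [U], stopped when their partial sums, which approximate
    [B (Z (k * h))], leave the ball of radius [del].  Summing these estimates
    along an arbitrary partition, again with stopping, bounds the error made by
    replacing [Rs] by its step approximation uniformly in the partition.  For a
    step function the Riemann sums converge by continuity in probability.

    For infinite divisibility, the processes [Z (j * t / n + s / n) -
    Z (j * t / n)], [j < n], are independent and identically distributed Levy
    processes; at each dyadic level their Riemann sums and the Riemann sum of
    [Z] assign the same operators to exchangeable increments, so the sum of
    their stochastic convolutions has the law of the one of [Z]. *)

(** * Random vectors *)

(** No moment of [Z] is assumed and its paths may have unbounded variation, so neither an L2
    isometry nor pathwise integration is at hand: uniformity in the partition has to come from
    truncation and stopping. Smallness of the paths is measured by one function [q] on [H], chosen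
    before any operator: the event where [q (Z s)] stays small then serves at once for all operators
    dominated by [q], whatever partition and tags produced them. For the step part, summation by
    parts leaves the partition visible only through [Z] at [2 ^ L] times close to dyadic ones.

    Cutting the integral at the times [j * t / n] would not give infinite divisibility: the pieces
    are independent, but they meet different operators and in general have different laws. Each
    block is therefore stretched back to all of [[0, t]], where it meets the whole family [Rs]. Laws
    of limits are compared directly on open sets, without characteristic functions, and independence
    passes to the limits because each is built measurable for the increments of its own block. *)

Section random_vectors.
Context {R : realType} {H : normedModType R} {d : measure_display}
  {Om : measurableType d}.
Implicit Types (X Y : Om -> H).

Local Notation borelH := (g_sigma_algebraType (@open H)).

Lemma open_borel (U : set H) : open U -> borel_sets U.
Proof. exact: sub_gen_smallest. Qed.

Lemma rvH_measurable_fun X : rvH X <-> measurable_fun setT (X : Om -> borelH).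
Proof.
split=> [h _ B mB|h B mB]; first by rewrite setTI; exact: h.
by have := h measurableT B mB; rewrite setTI.
Qed.

Lemma rvH_open X : (forall U, open U -> measurable (X @^-1` U)) -> rvH X.
Proof.
move=> h; apply/rvH_measurable_fun.
apply: (@measurability _ _ _ borelH _ X (@open H)) => //.
by move=> _ [U oU <-]; rewrite setTI; exact: h.
Qed.

Lemma rvH_cst (x : H) : rvH (fun _ : Om => x).
Proof.
move=> B _; rewrite preimage_cst; by case: ifP.
Qed.

Lemma rvH_comp (phi : H -> H) X :
  continuous phi -> rvH X -> rvH (phi \o X).
Proof.
move=> cphi rX; apply: rvH_open => U oU.
rewrite comp_preimage; apply: rX; apply: open_borel.
by move/continuousP: cphi; apply.
Qed.

Lemma rvH_continuous_real (g : H -> R) X :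
  continuous g -> rvH X -> measurable_fun setT (g \o X).
Proof.
move=> cg rX; apply: (measurability _ (RGenOpens.measurableE R)) => /=.
move=> _ [_ [a [b ->] <-]]; rewrite setTI comp_preimage; apply: rX.
by apply: open_borel; move/continuousP: cg; apply; exact: interval_open.
Qed.

Lemma rvH_norm_sub (u : H) X : rvH X -> measurable_fun setT (fun w => `|X w - u|).
Proof.
move=> rX; apply: (@rvH_continuous_real (fun x => `|x - u|)) => // x.
apply: (@cvg_norm R H); apply: cvgB; [exact: cvg_id|exact: cvg_cst].
Qed.

Lemma rvH_norm X : rvH X -> measurable_fun setT (fun w => `|X w|).
Proof. by move=> rX; apply: rvH_continuous_real => // x; exact: norm_continuous. Qed.

Lemma rvH_ifte (A : set Om) X Y : measurable A -> rvH X -> rvH Y ->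
  rvH (fun w => if w \in A then X w else Y w).
Proof.
move=> mA rX rY B mB.
have -> : (fun w => if w \in A then X w else Y w) @^-1` B =
    (A `&` X @^-1` B) `|` (~` A `&` Y @^-1` B).
  apply/seteqP; split=> w /=.
    by case: ifPn => [/set_mem Aw|/negP nA] ?; [left|right; split=> // /mem_set].
  move=> [[/mem_set ->//]|[nA]]; rewrite ifF//; apply/negbTE/negP => /set_mem //.
apply: measurableU; apply: measurableI => //; [exact: rX|exact: measurableC|exact: rY].
Qed.

End random_vectors.

(** * Inner product: Cauchy-Schwarz and polarization *)

Section inner_product.
Context {R : realType} {H : normedModType R} (ip : H -> H -> R).
Hypothesis ipH : is_inner_product ip.

Lemma ipC x y : ip x y = ip y x.
Proof. by have [] := ipH. Qed.

Lemma ip_norm x : ip x x = `|x| ^+ 2.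
Proof. by have [] := ipH. Qed.

Lemma ipDl x y z : ip (x + y) z = ip x z + ip y z.
Proof. by have [_ h _] := ipH; have := h 1 x y z; rewrite scale1r mul1r. Qed.

Lemma ip0l z : ip 0 z = 0.
Proof. by apply: (addIr (ip 0 z)); rewrite -ipDl !add0r. Qed.

Lemma ipZl c x z : ip (c *: x) z = c * ip x z.
Proof. by have [_ h _] := ipH; have := h c x 0 z; rewrite addr0 ip0l addr0. Qed.

Lemma ipDr x y z : ip x (y + z) = ip x y + ip x z.
Proof. by rewrite ipC ipDl !(ipC x). Qed.

Lemma normD_ip x y : `|x + y| ^+ 2 = `|x| ^+ 2 + 2 * ip x y + `|y| ^+ 2.
Proof. rewrite -!ip_norm ipDl !ipDr (ipC y x); ring. Qed.

Lemma ip_polar x y : ip x y = 2^-1 * (`|x + y| ^+ 2 - `|x| ^+ 2 - `|y| ^+ 2).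
Proof. by rewrite normD_ip; field. Qed.

(** The norm is given, so Cauchy-Schwarz is read off from its triangle inequality by expanding both
    squares. *)
Lemma ip_le_norm x y : ip x y <= `|x| * `|y|.
Proof.
have : `|x + y| ^+ 2 <= (`|x| + `|y|) ^+ 2.
  by rewrite lerXn2r ?nnegrE ?addr_ge0// ler_normD.
rewrite normD_ip sqrrD; nra.
Qed.

Lemma normr_ip_le x y : `|ip x y| <= `|x| * `|y|.
Proof.
rewrite ler_norml ip_le_norm andbT lerNl -mulN1r -ipZl scaleN1r.
by rewrite -(normrN x) ip_le_norm.
Qed.

End inner_product.

Lemma addr_split (V : zmodType) (x y z u : V) :
  x + y - z = (x - u) + (y - (z - u)).
Proof. by rewrite opprB !addrA (addrAC x (- u)) addrNK. Qed.

Lemma measurable_set_ltr (R : realType) (d : measure_display)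
    (T : measurableType d) (f g : T -> R) :
  measurable_fun setT f -> measurable_fun setT g -> measurable [set w | f w < g w].
Proof.
move=> mf mg; rewrite -[X in measurable X]setTI.
under eq_set do rewrite -lte_fin.
by apply: measurable_lte => //; exact/measurable_EFinP.
Qed.

(** * Measurability of vector operations in a separable space *)

Section separable.
Context {R : realType} {H : normedModType R} {d : measure_display}
  {Om : measurableType d}.
Implicit Types (X Y : Om -> H).
Hypothesis sepH : exists u : nat -> H, dense (range u).

Lemma dense_approx (u : nat -> H) (x : H) (e : R) :
  dense (range u) -> 0 < e -> exists i, `|x - u i| < e.
Proof.
move=> du e0.
have [|//|y [/= yx [i _ uiy]]] := du (ball x e).
  by exists x; exact: ballxx.
  exact: ball_open.
by exists i; rewrite uiy; move: yx; rewrite -ball_normE.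
Qed.

(** Separability enters here: an open set is a countable union of balls with radii [k.+1%:R^-1]
    around the dense points. *)
Lemma rvH_balls X :
  (forall (x : H) (e : R), measurable [set w | `|X w - x| < e]) -> rvH X.
Proof.
move=> h; have [u du] := sepH; apply: rvH_open => U oU.
pose C k i := if `[< ball (u i) k.+1%:R^-1 `<=` U >]
  then [set w | `|X w - u i| < k.+1%:R^-1] else set0.
have -> : X @^-1` U = \bigcup_k \bigcup_i C k i.
  apply/seteqP; split=> w /= => [Uw|[k _ [i _]]].
    have := oU; rewrite openE => /(_ _ Uw)/nbhs_ballP[e /= e0 eU].
    have [k] : exists k, 0 + k.+1%:R^-1 < e / 2 by apply: ltr_add_invr; rewrite divr_gt0.
    rewrite add0r => ke.
    have [i wi] : exists i, `|X w - u i| < k.+1%:R^-1.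
      by apply: dense_approx => //; rewrite invr_gt0.
    exists k => //; exists i => //; rewrite /C ifT//; apply/asboolP => y.
    rewrite -ball_normE /= => yi; apply: eU; rewrite -ball_normE /=.
    rewrite (le_lt_trans (ler_distD (u i) _ _))// [ltRHS](splitr e) ltrD//.
    - exact: lt_trans ke.
    - exact: lt_trans ke.
  rewrite /C; case: ifPn => // /asboolP iU Xi; apply: iU.
  by rewrite -ball_normE /= distrC.
apply: bigcup_measurable => k _; apply: bigcup_measurable => i _.
by rewrite /C; case: ifPn => // _; exact: h.
Qed.

(** The dense points [u i] act as approximate values of [X]: this writes the event as a countable
    union of intersections of an event of [X] alone with an event of [Y] alone. *)
Lemma rvHD X Y : rvH X -> rvH Y -> rvH (fun w => X w + Y w).
Proof.
move=> rX rY; have [u du] := sepH; apply: rvH_balls => x e.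
have -> : [set w | `|X w + Y w - x| < e] = \bigcup_k \bigcup_i
    ([set w | `|X w - u i| < k.+1%:R^-1] `&`
     [set w | `|Y w - (x - u i)| < e - k.+1%:R^-1]).
  apply/seteqP; split=> w /= => [we|[k _ [i _ [/= Xi Yi]]]].
    set a := e - `|X w + Y w - x|; have a0 : 0 < a by rewrite subr_gt0.
    (* [a / 2] because the radius is spent twice: in replacing [X w] by [u i], and in shrinking the
       ball for [Y w]. *)
    have [k] : exists k, 0 + k.+1%:R^-1 < a / 2 by apply: ltr_add_invr; rewrite divr_gt0.
    rewrite add0r => ka.
    have [i wi] : exists i, `|X w - u i| < k.+1%:R^-1.
      by apply: dense_approx => //; rewrite invr_gt0.
    exists k => //; exists i => //; split => //=.
    have -> : Y w - (x - u i) = (X w + Y w - x) - (X w - u i).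
      by rewrite (addr_split (X w) (Y w) x (u i)) [RHS]addrC addKr.
    rewrite (le_lt_trans (ler_normB _ _))//.
    rewrite /a in ka; move: (_^-1) wi ka => z wi ka; lra.
  have -> : X w + Y w - x = (X w - u i) + (Y w - (x - u i)).
    exact: addr_split.
  rewrite (le_lt_trans (ler_normD _ _))//; move: (_^-1) Xi Yi => z Xi Yi; lra.
apply: bigcup_measurable => k _; apply: bigcup_measurable => i _.
by apply: measurableI; apply: measurable_set_ltr;
  [exact: rvH_norm_sub|exact: measurable_cst|
   exact: rvH_norm_sub|exact: measurable_cst].
Qed.

Lemma rvHN X : rvH X -> rvH (fun w => - X w).
Proof. by apply: rvH_comp => x; exact: opp_continuous. Qed.

Lemma rvHB X Y : rvH X -> rvH Y -> rvH (fun w => X w - Y w).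
Proof. by move=> rX rY; apply: rvHD => //; exact: rvHN. Qed.

Lemma rvH_sum n (F : nat -> Om -> H) : (forall i, (i < n)%N -> rvH (F i)) ->
  rvH (fun w => \sum_(i < n) F i w).
Proof.
elim: n => [_|n IH h].
  under eq_fun do rewrite big_ord0.
  exact: rvH_cst.
under eq_fun do rewrite big_ord_recr /=.
by apply: rvHD; [apply: IH => i /ltnW; exact: h|exact: h].
Qed.

Lemma rvH_cvg (F : nat -> Om -> H) X : (forall i, rvH (F i)) ->
  (forall w, F ^~ w @ \oo --> X w) -> rvH X.
Proof.
move=> rF FX; apply: rvH_balls => x e; apply: measurable_set_ltr => //.
apply: (@measurable_fun_cvg _ _ _ setT (fun n w => `|F n w - x|)) => //.
  by move=> n; exact: rvH_norm_sub.
by move=> w _; apply: (@cvg_norm R H); apply: cvgB; [exact: FX|exact: cvg_cst].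
Qed.

(** Polarization reduces the claim to norms of random vectors. *)
Lemma measurable_ip (ip : H -> H -> R) X Y : is_inner_product ip ->
  rvH X -> rvH Y -> measurable_fun setT (fun w => ip (X w) (Y w)).
Proof.
move=> ipH rX rY.
have -> : (fun w => ip (X w) (Y w)) =
    (fun w => 2^-1 * (`|X w + Y w| ^+ 2 - `|X w| ^+ 2 - `|Y w| ^+ 2)).
  by apply/funext => w; rewrite ip_polar.
apply: measurable_funM => //; apply: measurable_funB; first apply: measurable_funB.
- by apply: measurable_funX; apply: rvH_norm; exact: rvHD.
- by apply: measurable_funX; exact: rvH_norm.
- by apply: measurable_funX; exact: rvH_norm.
Qed.
End separable.

(** * Bounded expectations and independence *)

Section bounded_expectation.
Context {R : realType} {d : measure_display} {Om : measurableType d}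
  (P : probability Om R).
Implicit Types (f g : Om -> R).

(** For a probability this class is integrable and closed under sums and products; truncation and
    stopping keep the expectations of the proof inside it. *)
Definition bmeas f := measurable_fun setT f /\ exists M : R, forall w, `|f w| <= M.

Lemma bmeas_integrable f : bmeas f -> P.-integrable setT (EFin \o f).
Proof.
move=> [mf [M fM]]; apply: measurable_bounded_integrable => //.
  by apply: (le_lt_trans (probability_le1 P measurableT)); exact: ltry.
exists M; split; first exact: num_real.
by move=> x Mx w _ /=; rewrite (le_trans (fM w))// ltW.
Qed.

Lemma bmeas_cst c : bmeas (fun=> c).
Proof. by split=> //; exists `|c|. Qed.

Lemma bmeasD f g : bmeas f -> bmeas g -> bmeas (fun w => f w + g w).
Proof.
move=> [mf [M fM]] [mg [N gN]]; split; first exact: measurable_funD.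
by exists (M + N) => w; rewrite (le_trans (ler_normD _ _))// lerD.
Qed.

Lemma bmeasM f g : bmeas f -> bmeas g -> bmeas (fun w => f w * g w).
Proof.
move=> [mf [M fM]] [mg [N gN]]; split; first exact: measurable_funM.
by exists (M * N) => w; rewrite normrM ler_pM.
Qed.

Lemma bmeas_indic (A : set Om) : measurable A -> bmeas (\1_A : Om -> R).
Proof.
move=> mA; split; first exact: measurable_indic.
by exists 1 => w; rewrite indicE ger0_norm ?ler0n// lern1 leq_b1.
Qed.

Lemma Rintegral_prob_cst c : \int[P]_w c = c.
Proof.
rewrite Rintegral_cst//; have -> : fine (P setT) = 1 by rewrite probability_setT.
by rewrite mulr1.
Qed.

Lemma RintegralD_bmeas f g : bmeas f -> bmeas g ->
  \int[P]_w (f w + g w) = \int[P]_w f w + \int[P]_w g w.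
Proof. by move=> bf bg; rewrite RintegralD//; exact: bmeas_integrable. Qed.

Lemma RintegralZl_bmeas f c : bmeas f -> \int[P]_w (c * f w) = c * \int[P]_w f w.
Proof. by move=> bf; rewrite RintegralZl//; exact: bmeas_integrable. Qed.

Lemma Rintegral_indicE (A : set Om) : measurable A ->
  \int[P]_w (\1_A w : R) = fine (P A).
Proof. by move=> mA; rewrite /Rintegral integral_indic// setIT. Qed.

Lemma le_Rintegral_bmeas f g : bmeas f -> bmeas g -> (forall w, f w <= g w) ->
  \int[P]_w f w <= \int[P]_w g w.
Proof.
by move=> bf bg fg; apply: le_Rintegral => //; exact: bmeas_integrable.
Qed.

Lemma normr_Rintegral_le f M : measurable_fun setT f -> (forall w, `|f w| <= M) ->
  `|\int[P]_w f w| <= M.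
Proof.
move=> mf fM; have bf : bmeas f by split=> //; exists M.
rewrite ler_norml -{1}(Rintegral_prob_cst (- M)) -{2}(Rintegral_prob_cst M).
by rewrite !le_Rintegral_bmeas//; try exact: bmeas_cst;
  move=> w; have := fM w; rewrite ler_norml => /andP[].
Qed.

Lemma fine_probE (A : set Om) : measurable A -> ((fine (P A))%:E = P A)%E.
Proof. by move=> mA; rewrite fineK// fin_num_measure. Qed.

End bounded_expectation.

(** * Independence of sigma-algebras and of random elements *)

Section independence.
Context {R : realType} {d : measure_display} {Om : measurableType d}
  (P : probability Om R).

(** As functions of [B], both sides are finite measures, a restriction and a multiple of [P], that
    agree on a pi-system. *)
Lemma indep_event_generated (A : set Om) (G : set (set Om)) :
  measurable A -> G `<=` measurable -> setI_closed G -> G setT ->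
  (forall B, G B -> P (A `&` B) = (P A * P B)%E) ->
  forall B, <<s G >> B -> P (A `&` B) = (P A * P B)%E.
Proof.
move=> mA Gm GI GT h B GB.
have pA : 0 <= fine (P A) by rewrite fine_ge0.
pose m2 := mscale (NngNum pA) P.
have m2E C : m2 C = (P A * P C)%E by rewrite -(fine_probE P mA).
have m1E C : mrestr P mA C = P (A `&` C) by rewrite setIC.
rewrite -m1E -m2E.
apply: (g_sigma_algebra_measure_unique G Gm (fun=> setT)) => //.
- by rewrite bigcup_const.
- by move=> C GC; rewrite [LHS]m1E [RHS]m2E h.
- by move=> _; rewrite [ltLHS]m1E setIT (le_lt_trans (probability_le1 _ mA))// ltry.
Qed.

Lemma indep_generated (F G : set (set Om)) :
  F `<=` measurable -> setI_closed F -> F setT ->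
  G `<=` measurable -> setI_closed G -> G setT ->
  (forall A B, F A -> G B -> P (A `&` B) = (P A * P B)%E) ->
  forall A B, <<s F >> A -> <<s G >> B -> P (A `&` B) = (P A * P B)%E.
Proof.
move=> Fm FI FT Gm GI GT h A B FA GB.
have GBm : measurable B.
  by apply: (smallest_sub _ Gm) GB; exact: sigma_algebra_measurable.
rewrite setIC muleC; apply: (indep_event_generated GBm Fm FI FT) FA => C FC.
rewrite setIC muleC; apply: (indep_event_generated (Fm _ FC) Gm GI GT) GB => D GD.
exact: h.
Qed.

Context {d1 d2 : measure_display} {T1 : measurableType d1} {T2 : measurableType d2}.

(** Independence on rectangles identifies the law of the pair with the product of the two laws;
    Fubini's theorem does the rest. *)
Lemma Rintegral_indep (V : Om -> T1) (U : Om -> T2) (g : T1 * T2 -> R) :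
  measurable_fun setT V -> measurable_fun setT U ->
  (forall A B, measurable A -> measurable B ->
     P (V @^-1` A `&` U @^-1` B) = (P (V @^-1` A) * P (U @^-1` B))%E) ->
  bmeas g ->
  \int[P]_w g (V w, U w) = \int[P]_w \int[P]_w' g (V w, U w').
Proof.
move=> mV mU VU bg; have [mg [M gM]] := bg.
pose Vf : {mfun Om >-> T1} := HB.pack V (isMeasurableFun.Build _ _ _ _ _ mV).
pose Uf : {mfun Om >-> T2} := HB.pack U (isMeasurableFun.Build _ _ _ _ _ mU).
have mW : measurable_fun setT (fun w => (V w, U w)) by exact: measurable_fun_pair.
pose Wf : {mfun Om >-> (T1 * T2)%type} :=
  HB.pack (fun w => (V w, U w)) (isMeasurableFun.Build _ _ _ _ _ mW).
pose m1 := distribution P Vf.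
pose m2 := distribution P Uf.
have bsec x : bmeas (fun w => g (x, U w)).
  split; last by exists M.
  apply: measurableT_comp => //; exact: measurable_fun_pair.
have bW : bmeas (fun w => g (V w, U w)).
  by split; [exact: measurableT_comp|exists M].
have e1 : (\int[P]_w (g (V w, U w))%:E = \int[m1 \x m2]_z (g z)%:E)%E.
  rewrite (eq_measure_integral (distribution P Wf)); last first.
    move=> A mA _; exact: product_measure_unique.
  rewrite /distribution integral_pushforward//; first exact/measurable_EFinP.
  exact: bmeas_integrable bW.
have ig : (m1 \x m2)%E.-integrable setT (EFin \o g) by exact: bmeas_integrable.
have F_eq x : (\int[m2]_y (g (x, y))%:E = (\int[P]_w (g (x, U w)))%:E)%E.
  rewrite /m2 /distribution integral_pushforward//; last 2 first.
  - apply/measurable_EFinP; apply: measurableT_comp => //; exact: measurable_fun_pair.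
  - exact: bmeas_integrable (bsec x).
  rewrite preimage_setT /Rintegral fineK//.
  exact/integrable_fin_num/bmeas_integrable.
rewrite {1}/Rintegral e1 -(integral12_prod_meas1 ig) /fubini_F.
rewrite [in RHS]/Rintegral; congr fine.
have mF : measurable_fun setT (fun x => \int[P]_w g (x, U w)).
  apply/measurable_EFinP.
  have -> : EFin \o (fun x => \int[P]_w g (x, U w)) = fubini_F m2 (EFin \o g).
    by apply/funext => x; rewrite /fubini_F /= F_eq.
  exact: measurable_fubini_F ig.
transitivity (\int[m1]_x (\int[P]_w g (x, U w))%:E)%E.
  by apply: eq_integral => x _; rewrite /= F_eq.
have mFE : measurable_fun setT (fun x => (\int[P]_w g (x, U w))%:E).
  exact/measurable_EFinP.
have iF : P.-integrable (V @^-1` setT)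
    ((fun x => (\int[P]_w g (x, U w))%:E) \o V).
  apply: (@bmeas_integrable _ _ _ _ (fun w => \int[P]_w' g (V w, U w'))).
  split; first exact: measurableT_comp mF mV.
  by exists M => w; apply: normr_Rintegral_le => //; have [] := bsec (V w).
by rewrite /m1 /distribution (integral_pushforward mV mFE iF).
Qed.

End independence.

(** * Cylinder events of sequences of random vectors *)

Section cylinders.
Context {R : realType} {H : normedModType R} {T : Type}.
Implicit Types (X : nat -> T -> H).

(** Only rectangles, a pi-system on which independence factorizes. [T] carries no sigma-algebra, so
    the same notion serves for random sequences and for the coordinate maps on [nat -> H]. *)
Definition cyl X (a b : nat) : set (set T) :=
  [set A | exists2 B : nat -> set H, (forall i, borel_sets (B i)) &
     A = \bigcap_(i in [set i | (a <= i < b)%N]) (X i @^-1` B i)].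

Lemma borel_setT : borel_sets [set: H].
Proof. by apply: open_borel; exact: openT. Qed.

Lemma borel_setI (A B : set H) : borel_sets A -> borel_sets B -> borel_sets (A `&` B).
Proof. exact: (@measurableI _ (g_sigma_algebraType (@open H))). Qed.

Lemma cyl_setI_closed X a b : setI_closed (cyl X a b).
Proof.
move=> _ _ [B mB ->] [C mC ->]; exists (fun i => B i `&` C i).
  by move=> i; exact: borel_setI.
by rewrite -bigcapI.
Qed.

Lemma cyl_setT X a b : cyl X a b setT.
Proof.
exists (fun=> setT); first by move=> _; exact: borel_setT.
by apply/seteqP; split.
Qed.

Lemma cyl_coord X a b i : (a <= i < b)%N ->
  forall B, borel_sets B -> <<s cyl X a b >> (X i @^-1` B).
Proof.
move=> iab B mB; apply: sub_sigma_algebra.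
exists (fun j => if j == i then B else setT).
  by move=> j; case: ifP => // _; exact: borel_setT.
apply/seteqP; split=> w /=.
  by move=> Bw j _ /=; case: eqP => [->|].
by move=> /(_ i iab) /=; rewrite eqxx.
Qed.

End cylinders.

Section cylinder_measurability.
Context {R : realType} {H : normedModType R} {d : measure_display}
  {Om : measurableType d}.
Implicit Types (X : nat -> Om -> H).

Lemma cyl_measurable X a b : (forall i, (a <= i < b)%N -> rvH (X i)) ->
  cyl X a b `<=` measurable.
Proof.
move=> rX _ [B mB ->]; apply: fin_bigcap_measurable.
  by apply: (@sub_finite_set _ _ `I_b) => // i /= /andP[].
by move=> i iab; exact: rX.
Qed.

Lemma cyl_generated_measurable X a b : (forall i, (a <= i < b)%N -> rvH (X i)) ->
  <<s cyl X a b >> `<=` measurable.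
Proof.
move=> rX; apply: smallest_sub; first exact: sigma_algebra_measurable.
exact: cyl_measurable.
Qed.

End cylinder_measurability.

Section independent_families.
Context {R : realType} {H : normedModType R} {d : measure_display}
  {Om : measurableType d} (P : probability Om R).
Implicit Types (X : nat -> Om -> H).

Lemma indep_blocks X n a b : indep_family P n X -> (forall i, (i < n)%N -> rvH (X i)) ->
  (b <= n)%N -> forall A B, <<s cyl X 0 a >> A -> <<s cyl X a b >> B ->
  (a <= b)%N -> P (A `&` B) = (P A * P B)%E.
Proof.
move=> iX rX bn A B sA sB ab; move: A B sA sB.
have an : (a <= n)%N by exact: leq_trans bn.
apply: indep_generated.
- by apply: cyl_measurable => i /andP[_ ia]; apply: rX; exact: leq_trans an.
- exact: cyl_setI_closed.
- exact: cyl_setT.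
- by apply: cyl_measurable => i /andP[_ ib]; apply: rX; exact: leq_trans bn.
- exact: cyl_setI_closed.
- exact: cyl_setT.
move=> _ _ [B mB ->] [C mC ->].
(* Both rectangles are padded to all [n] coordinates; at each index at least one of the two factors
   is [setT], so the product splits. *)
pose B' i := if (i < a)%N then B i else setT.
pose C' i := if (a <= i < b)%N then C i else setT.
have mB' i : borel_sets (B' i) by rewrite /B'; case: ifP => // _; exact: borel_setT.
have mC' i : borel_sets (C' i) by rewrite /C'; case: ifP => // _; exact: borel_setT.
have -> : \bigcap_(i in [set i | (0 <= i < a)%N]) (X i @^-1` B i) =
    \bigcap_(i < n) (X i @^-1` B' i).
  apply/seteqP; split=> w h i /= ni.
    by rewrite /B'; case: ifP => // ia; apply: (h i).
  by have := h i (leq_trans ni an); rewrite /B' /= ni.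
have -> : \bigcap_(i in [set i | (a <= i < b)%N]) (X i @^-1` C i) =
    \bigcap_(i < n) (X i @^-1` C' i).
  apply/seteqP; split=> w h i /= ni.
    by rewrite /C'; case: ifP => // ia; apply: (h i).
  by have /= := h i (leq_trans (andP ni).2 bn); rewrite /C' /= ni.
rewrite -bigcapI; under eq_bigcapr do rewrite -preimage_setI.
rewrite !iX//; last by move=> i; exact: borel_setI.
rewrite -big_split /=; apply: eq_bigr => i _.
rewrite /B' /C'; case: ifPn => ia.
  by rewrite leqNgt ia /= setIT preimage_setT probability_setT mule1.
by rewrite setTI preimage_setT probability_setT mul1e.
Qed.

(** Independence determines the joint law of the first [n] coordinates on rectangles, hence on the
    sigma-algebra they generate on [nat -> H], for which [g] is measurable. *)
Lemma indep_family_same_law X X' n (g : (nat -> H) -> H) :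
  indep_family P n X -> (forall i, (i < n)%N -> rvH (X i)) ->
  indep_family P n X' -> (forall i, (i < n)%N -> rvH (X' i)) ->
  (forall i B, (i < n)%N -> borel_sets B -> P (X i @^-1` B) = P (X' i @^-1` B)) ->
  (forall B, borel_sets B ->
    <<s cyl (fun i (x : nat -> H) => x i) 0 n >> (g @^-1` B)) ->
  forall B, borel_sets B ->
    P ((fun w => g (X ^~ w)) @^-1` B) = P ((fun w => g (X' ^~ w)) @^-1` B).
Proof.
move=> iX rX iX' rX' XX' rg B mB.
set C := cyl _ 0 n in rg.
have mf (Y : nat -> Om -> H) : (forall i, (i < n)%N -> rvH (Y i)) ->
    measurable_fun setT ((fun w => Y ^~ w) : Om -> g_sigma_algebraType C).
  move=> rY.
  apply: (@measurability _ _ _ (g_sigma_algebraType C) _ _ C) => //.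
  move=> _ [_ [D mD ->] <-]; rewrite setTI preimage_bigcap.
  apply: fin_bigcap_measurable; first by apply: (@sub_finite_set _ _ `I_n).
  by move=> i /= ni; exact: rY.
pose f : {mfun Om >-> g_sigma_algebraType C} :=
  HB.pack (fun w => X ^~ w) (isMeasurableFun.Build _ _ _ _ _ (mf X rX)).
pose f' : {mfun Om >-> g_sigma_algebraType C} :=
  HB.pack (fun w => X' ^~ w) (isMeasurableFun.Build _ _ _ _ _ (mf X' rX')).
have := @measure_unique _ R (g_sigma_algebraType C) C (fun=> setT) erefl
  (@cyl_setI_closed _ _ _ _ _ _) (fun=> @cyl_setT _ _ _ _ _ _) _
  (pushforward P f) (pushforward P f') _ _ (g @^-1` B) (rg B mB).
apply.
- by rewrite bigcup_const.
- move=> _ [D mD ->]; rewrite /= /pushforward !preimage_bigcap /=.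
  have := iX D mD; have := iX' D mD.
  rewrite /=; under eq_bigcapr do rewrite /=.
  move=> e1 e2; rewrite [LHS]e2 [RHS]e1; apply: eq_bigr => i _; exact: XX'.
- by move=> _; rewrite /= /pushforward preimage_setT probability_setT ltry.
Qed.

End independent_families.

(** * Stopped sums and Wald's identities *)

Lemma lipschitz_continuous (R : realType) (V W : normedModType R) (c : R) (f : V -> W) :
  (forall x y, `|f x - f y| <= c * `|x - y|) -> continuous f.
Proof.
move=> fc x; apply/cvgrPdist_lt => e e0; near=> y.
rewrite (le_lt_trans (fc x y))// (@le_lt_trans _ _ ((`|c| + 1) * `|x - y|))//.
  by rewrite ler_wpM2r// (le_trans (ler_norm c))// lerDl.
rewrite mulrC -ltr_pdivlMr ?ltr_wpDl//; near: y.
by apply/nbhs_normP; exists (e / (`|c| + 1)) => //=; rewrite divr_gt0// ltr_wpDl.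
Unshelve. all: by end_near. Qed.

Section stopped_sums.
Context {R : realType} {H : normedModType R} (ip : H -> H -> R).
Hypothesis ipH : is_inner_product ip.
Hypothesis sepH : exists u : nat -> H, dense (range u).

(** The walk freezes at its first value outside the ball, overshoot included. Whether it moves is
    decided by the current position alone, which is independent of the next summand. *)
Definition stop_step (lam : R) (x z : H) : H := if `|x| <= lam then x + z else x.

Fixpoint stopped (T : Type) (lam : R) (zeta : nat -> T -> H) (k : nat) (w : T) : H :=
  if k is k'.+1 then stop_step lam (stopped lam zeta k' w) (zeta k' w) else 0.

Lemma norm_stop_step_le lam del x z : `|z| <= del -> 0 <= del -> `|x| <= lam + del ->
  `|stop_step lam x z| <= lam + del.
Proof.
move=> zd d0 xd; rewrite /stop_step; case: ifPn => // xl.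
by rewrite (le_trans (ler_normD _ _))// lerD.
Qed.

Lemma norm_stopped_le (T : Type) lam del (zeta : nat -> T -> H) k w :
  0 <= lam -> 0 <= del ->
  (forall i, (i < k)%N -> `|zeta i w| <= del) -> `|stopped lam zeta k w| <= lam + del.
Proof.
move=> l0 d0; elim: k => [|k IH] /= zd; first by rewrite normr0 addr_ge0.
by apply: norm_stop_step_le => //; [exact: zd|apply: IH => i /ltnW; exact: zd].
Qed.

(** A frozen walk stays outside the ball, so a final value inside it means that no step was
    refused. *)
Lemma stopped_sum (T : Type) lam (zeta : nat -> T -> H) k w :
  `|stopped lam zeta k w| <= lam -> stopped lam zeta k w = \sum_(i < k) zeta i w.
Proof.
elim: k => [|k IH] /=; first by rewrite big_ord0.
rewrite big_ord_recr /= {2}/stop_step {1}/stop_step.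
by case: ifPn => [xl _|/negP//]; rewrite IH.
Qed.

Lemma sum_stopped (T : Type) lam (zeta : nat -> T -> H) k w :
  (forall j, (j < k)%N -> `|\sum_(i < j) zeta i w| <= lam) ->
  stopped lam zeta k w = \sum_(i < k) zeta i w.
Proof.
elim: k => [|k IH] h /=; first by rewrite big_ord0.
rewrite big_ord_recr /= /stop_step IH; first by rewrite h.
by move=> j jk; apply: h; exact: ltnW.
Qed.

Lemma ip_stop_step lam x z y :
  ip (stop_step lam x z) y = ip x y + (`|x| <= lam)%R%:R * ip z y.
Proof.
rewrite /stop_step; case: ifPn => _; first by rewrite (ipDl ipH) mul1r.
by rewrite mul0r addr0.
Qed.

Lemma norm_stop_step lam x z : `|stop_step lam x z| ^+ 2 =
  `|x| ^+ 2 + (`|x| <= lam)%R%:R * (2 * ip x z + `|z| ^+ 2).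
Proof.
rewrite /stop_step; case: ifPn => _; first by rewrite (normD_ip ipH) mul1r addrA.
by rewrite mul0r addr0.
Qed.

Section measurability.
Context {d : measure_display} {Om : measurableType d}.

Lemma measurable_norm_le (X : Om -> H) lam : rvH X ->
  measurable [set w | `|X w| <= lam].
Proof.
move=> rX; rewrite -[X in measurable X]setTI; apply: measurable_fun_le => //.
exact: rvH_norm.
Qed.

Lemma measurable_indic_norm_le (X : Om -> H) lam : rvH X ->
  measurable_fun setT (fun w => (`|X w| <= lam)%R%:R : R).
Proof.
move=> rX.
have -> : (fun w => (`|X w| <= lam)%R%:R : R) = \1_[set w | `|X w| <= lam].
  apply/funext => w; rewrite indicE; congr (_ _); congr nat_of_bool.
  by apply/idP/idP => [/mem_set|/set_mem].
by apply: measurable_indic; exact: measurable_norm_le.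
Qed.

Lemma rvH_stop_step lam (X Y : Om -> H) : rvH X -> rvH Y ->
  rvH (fun w => stop_step lam (X w) (Y w)).
Proof.
move=> rX rY.
have := rvH_ifte (measurable_norm_le lam rX) (rvHD sepH rX rY) rX.
congr (rvH _); apply/funext => w; rewrite /stop_step; congr (if _ then _ else _).
by apply/idP/idP => [/set_mem|/mem_set].
Qed.

Lemma rvH_stopped lam (zeta : nat -> Om -> H) k :
  (forall i, (i < k)%N -> rvH (zeta i)) -> rvH (stopped lam zeta k).
Proof.
elim: k => [|k IH] h; first exact: rvH_cst.
by apply: rvH_stop_step; [apply: IH => i /ltnW; exact: h|exact: h].
Qed.

End measurability.

Section expectation.
Context {d : measure_display} {Om : measurableType d} (P : probability Om R).
Local Notation borelH := (g_sigma_algebraType (@open H)).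

Lemma Rintegral_indepH (V U : Om -> H) (g : H -> H -> R) (a b M : R) :
  rvH V -> rvH U ->
  (forall A B, borel_sets A -> borel_sets B ->
     P (V @^-1` A `&` U @^-1` B) = (P (V @^-1` A) * P (U @^-1` B))%E) ->
  (forall w, `|V w| <= a) -> (forall w, `|U w| <= b) ->
  measurable_fun setT (fun z : borelH * borelH => g z.1 z.2) ->
  (forall x y, `|x| <= a -> `|y| <= b -> `|g x y| <= M) ->
  \int[P]_w g (V w) (U w) = \int[P]_w \int[P]_w' g (V w) (U w').
Proof.
move=> rV rU VU Va Ub mg gM.
(* [g] may be unbounded; the indicators cut it off to balls that contain all values of [V] and [U],
   where it is unchanged. *)
pose g' (z : borelH * borelH) : R :=
  (`|z.1 : H| <= a)%R%:R * (`|z.2 : H| <= b)%R%:R * g z.1 z.2.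
have gE w w' : g (V w) (U w') = g' (V w, U w') by rewrite /g' /= Va Ub !mul1r.
have r1 : rvH (fst : borelH * borelH -> H) by apply/rvH_measurable_fun.
have r2 : rvH (snd : borelH * borelH -> H) by apply/rvH_measurable_fun.
have bg' : bmeas g'.
  split.
    by do 2 apply: measurable_funM => //; exact: measurable_indic_norm_le.
  exists `|M| => z; rewrite /g' !normrM.
  case: (leP `|z.1 : H| a) => za; last by rewrite normr0 !mul0r.
  case: (leP `|z.2 : H| b) => zb; last by rewrite normr0 mulr0 mul0r.
  by rewrite normr1 !mul1r (le_trans (gM _ _ za zb))// ler_norm.
transitivity (\int[P]_w g' (V w, U w)).
  by apply: eq_Rintegral => w _; rewrite gE.
have mV : measurable_fun setT (V : Om -> borelH) by apply/rvH_measurable_fun.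
have mU : measurable_fun setT (U : Om -> borelH) by apply/rvH_measurable_fun.
rewrite (@Rintegral_indep _ _ _ P _ _ borelH borelH V U g' mV mU VU bg').
by apply: eq_Rintegral => w _; apply: eq_Rintegral => w' _; rewrite gE.
Qed.

Lemma bmeas_ip (X Y : Om -> H) a b : rvH X -> rvH Y ->
  (forall w, `|X w| <= a) -> (forall w, `|Y w| <= b) ->
  bmeas (fun w => ip (X w) (Y w)).
Proof.
move=> rX rY Xa Yb; split; first exact: measurable_ip.
by exists (a * b) => w; rewrite (le_trans (normr_ip_le ipH _ _))// ler_pM.
Qed.

Lemma bmeas_sqr_norm (X : Om -> H) a : rvH X ->
  (forall w, `|X w| <= a) -> bmeas (fun w => `|X w| ^+ 2).
Proof.
move=> rX Xa; split; first by apply: measurable_funX; exact: rvH_norm.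
by exists (a ^+ 2) => w; rewrite ger0_norm ?sqr_ge0// lerXn2r ?nnegrE// (le_trans _ (Xa w)).
Qed.

Lemma bmeas_norm_le (X : Om -> H) lam : rvH X ->
  bmeas (fun w => (`|X w| <= lam)%R%:R : R).
Proof.
move=> rX; split; first exact: measurable_indic_norm_le.
by exists 1 => w; case: (`|X w| <= lam); rewrite ?normr0 ?normr1.
Qed.

Lemma Rintegral_norm_le (X : Om -> H) lam : rvH X ->
  \int[P]_w ((`|X w| <= lam)%R%:R : R) = fine (P [set w | `|X w| <= lam]).
Proof.
move=> rX; rewrite -(Rintegral_indicE P (measurable_norm_le lam rX)).
apply: eq_Rintegral => w _; rewrite indicE; congr (_ _); congr nat_of_bool.
by apply/idP/idP => [/mem_set|/set_mem].
Qed.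

Section one_step.
Variables (V U : Om -> H) (a del lam : R).
Hypotheses (rV : rvH V) (rU : rvH U)
  (VU : forall A B, borel_sets A -> borel_sets B ->
     P (V @^-1` A `&` U @^-1` B) = (P (V @^-1` A) * P (U @^-1` B))%E)
  (Va : forall w, `|V w| <= a) (Ud : forall w, `|U w| <= del) (lam0 : 0 <= lam).

Let r1 : rvH (fst : borelH * borelH -> H). Proof. exact/rvH_measurable_fun. Qed.
Let r2 : rvH (snd : borelH * borelH -> H). Proof. exact/rvH_measurable_fun. Qed.

Lemma Rintegral_ip_stop_step y :
  \int[P]_w ip (stop_step lam (V w) (U w)) y = \int[P]_w ip (V w) y +
    fine (P [set w | `|V w| <= lam]) * \int[P]_w ip (U w) y.
Proof.
have ry : rvH (fun _ : Om => y) by exact: rvH_cst.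
have yy (w : Om) : `|y| <= `|y| by [].
have bU := bmeas_ip rU ry Ud yy.
have bV := bmeas_ip rV ry Va yy.
rewrite (@Rintegral_indepH V U (fun x z => ip (stop_step lam x z) y) a del
  ((a + del) * `|y|))//; last 2 first.
- by apply: measurable_ip => //; [exact: rvH_stop_step|exact: rvH_cst].
- move=> x z xa zd; rewrite (le_trans (normr_ip_le ipH _ _))// ler_wpM2r//.
  rewrite /stop_step; case: ifPn => _.
    by rewrite (le_trans (ler_normD _ _))// lerD.
  by rewrite ler_wpDr// (le_trans _ zd).
transitivity (\int[P]_w (ip (V w) y +
    (\int[P]_w' ip (U w') y) * (`|V w| <= lam)%R%:R)).
  apply: eq_Rintegral => w _.
  under eq_Rintegral do rewrite ip_stop_step.
  rewrite RintegralD_bmeas; [|exact: bmeas_cst|by apply: bmeasM => //; exact: bmeas_cst].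
  by rewrite Rintegral_prob_cst RintegralZl_bmeas// mulrC.
rewrite RintegralD_bmeas//; last first.
  by apply: bmeasM; [exact: bmeas_cst|exact: bmeas_norm_le].
by rewrite RintegralZl_bmeas ?Rintegral_norm_le// 1?mulrC//; exact: bmeas_norm_le.
Qed.

(** The cross term alone spoils additivity of second moments. Given [V], it pairs [V] with the mean
    of [U], which costs at most [c] times the norm of [V], and the indicator keeps that norm below
    [lam]. The mean enters only through its pairings with vectors, which avoids a vector-valued
    integral. *)
Lemma Rintegral_norm_stop_step c : 0 <= c ->
  (forall y, `|\int[P]_w ip (U w) y| <= c * `|y|) ->
  `|\int[P]_w `|stop_step lam (V w) (U w)| ^+ 2 - (\int[P]_w `|V w| ^+ 2 +
    fine (P [set w | `|V w| <= lam]) * \int[P]_w `|U w| ^+ 2)| <= 2 * lam * c.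
Proof.
move=> c0 Uc.
have bU := bmeas_sqr_norm rU Ud.
have bV := bmeas_sqr_norm rV Va.
rewrite (@Rintegral_indepH V U (fun x z => `|stop_step lam x z| ^+ 2) a del
  ((a + del) ^+ 2))//; last 2 first.
- by apply: measurable_funX; apply: rvH_norm; exact: rvH_stop_step.
- move=> x z xa zd; rewrite ger0_norm ?sqr_ge0// lerXn2r ?nnegrE//.
    by rewrite addr_ge0// ?(le_trans _ xa)// (le_trans _ zd).
  rewrite /stop_step; case: ifPn => _.
    by rewrite (le_trans (ler_normD _ _))// lerD.
  by rewrite ler_wpDr// (le_trans _ zd).
pose J w : R := (`|V w| <= lam)%R%:R.
have bJ : bmeas J by exact: bmeas_norm_le.
pose K w := \int[P]_w' ip (U w') (V w).
have E w : \int[P]_w' (`|stop_step lam (V w) (U w')| ^+ 2) =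
    `|V w| ^+ 2 + (\int[P]_w' `|U w'| ^+ 2) * J w + 2 * J w * K w.
  under eq_Rintegral do rewrite norm_stop_step.
  have rVw : rvH (fun _ : Om => V w) by exact: rvH_cst.
  have bUV : bmeas (fun w' => ip (V w) (U w')).
    by apply: (@bmeas_ip _ _ a del) => // _.
  rewrite RintegralD_bmeas; [|exact: bmeas_cst|].
    rewrite Rintegral_prob_cst RintegralZl_bmeas; last first.
      by apply: bmeasD => //; apply: bmeasM => //; exact: bmeas_cst.
    rewrite RintegralD_bmeas//; last by apply: bmeasM => //; exact: bmeas_cst.
    have -> : K w = \int[P]_w' ip (V w) (U w').
      by apply: eq_Rintegral => w' _; rewrite (ipC ipH).
    rewrite RintegralZl_bmeas// -/(J w); ring.
  apply: bmeasM; first exact: bmeas_cst.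
  by apply: bmeasD => //; apply: bmeasM => //; exact: bmeas_cst.
have JK w : `|2 * J w * K w| <= 2 * lam * c.
  rewrite /J; case: (leP `|V w| lam) => Vl; last by rewrite mulr0 mul0r normr0 !mulr_ge0.
  rewrite mulr1 normrM ger0_norm// -mulrA ler_pM2l//.
  by rewrite (le_trans (Uc _))// mulrC ler_wpM2r.
have bip x : bmeas (fun w => ip (U w) x).
  by apply: (@bmeas_ip _ _ del `|x|) => //; exact: rvH_cst.
(* [K] is a Lipschitz function of [V w], with constant [c]. *)
have mK : measurable_fun setT K.
  apply: (@rvH_continuous_real _ _ _ _ (fun x => \int[P]_w ip (U w) x)) => //.
  apply: (@lipschitz_continuous _ _ _ c) => x y.
  rewrite -[in X in `|X - _|](subrK y x).
  under eq_Rintegral do rewrite (ipDr ipH).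
  by rewrite RintegralD_bmeas// addrK.
have mJK : measurable_fun setT (fun w => 2 * J w * K w).
  by do 2 apply: measurable_funM => //; have [] := bJ.
under eq_Rintegral do rewrite E.
have b1 : bmeas (fun w => (\int[P]_w' `|U w'| ^+ 2) * J w).
  by apply: bmeasM => //; exact: bmeas_cst.
rewrite RintegralD_bmeas; [|exact: bmeasD|by split=> //; exists (2 * lam * c)].
rewrite RintegralD_bmeas// RintegralZl_bmeas// Rintegral_norm_le//.
rewrite [_ * fine _]mulrC addrAC subrr add0r.
exact: normr_Rintegral_le.
Qed.

End one_step.

End expectation.
End stopped_sums.

Section real_probability.
Context {R : realType} {d : measure_display} {Om : measurableType d}
  (P : probability Om R).

Lemma fine_prob_ge0 A : 0 <= fine (P A).
Proof. by rewrite fine_ge0. Qed.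

Lemma fine_prob_le A B : measurable A -> measurable B -> A `<=` B ->
  fine (P A) <= fine (P B).
Proof.
by move=> mA mB AB; rewrite fine_le ?fin_num_measure// le_measure ?inE.
Qed.

Lemma fine_probU A B : measurable A -> measurable B ->
  fine (P (A `|` B)) <= fine (P A) + fine (P B).
Proof.
move=> mA mB; rewrite -fineD ?fin_num_measure//.
rewrite fine_le ?fin_numD ?fin_num_measure//; first exact: measurableU.
exact: measureU2.
Qed.

Lemma fine_prob_setC A : measurable A -> fine (P (~` A)) = 1 - fine (P A).
Proof. by move=> mA; rewrite probability_setC// fineB// fin_num_measure. Qed.

Lemma fine_prob_le1 A : measurable A -> fine (P A) <= 1.
Proof.
by move=> mA; rewrite -lee_fin fine_probE// probability_le1.
Qed.

End real_probability.

(** * Wald's identities, the second one with an error term for nonzero means *)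

Section wald.
Context {R : realType} {H : normedModType R} (ip : H -> H -> R).
Hypothesis ipH : is_inner_product ip.
Hypothesis sepH : exists u : nat -> H, dense (range u).
Context {d : measure_display} {Om : measurableType d} (P : probability Om R).
Variables (n : nat) (zeta : nat -> Om -> H) (lam del : R).
Hypotheses (lam0 : 0 <= lam) (del0 : 0 <= del).
Hypothesis izeta : indep_family P n zeta.
Hypothesis rzeta : forall i, (i < n)%N -> rvH (zeta i).
Hypothesis zeta_del : forall i w, (i < n)%N -> `|zeta i w| <= del.

Let S := stopped lam zeta.

Let rS k : (k <= n)%N -> rvH (S k).
Proof.
by move=> kn; apply: rvH_stopped => // i ik; apply: rzeta; exact: leq_trans kn.
Qed.

Lemma stopped_bound k w : (k <= n)%N -> `|S k w| <= lam + del.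
Proof.
move=> kn; apply: norm_stopped_le => // i ik; apply: zeta_del; exact: leq_trans kn.
Qed.

Let indepS k : (k < n)%N -> forall A B, borel_sets A -> borel_sets B ->
  P (S k @^-1` A `&` zeta k @^-1` B) = (P (S k @^-1` A) * P (zeta k @^-1` B))%E.
Proof.
move=> kn A B mA mB; apply: (indep_blocks (a := k) (b := k.+1) izeta) => //.
(* The measurability lemma is applied to [Om] equipped with the sigma-algebra of the first [k]
   summands, so it yields adaptedness of the walk. *)
- apply: (@rvH_stopped _ _ sepH _ (g_sigma_algebraType (cyl zeta 0 k)) lam zeta k _ A mA).
  by move=> i ik C mC; exact: cyl_coord.
- by apply: cyl_coord => //; rewrite leqnn ltnSn.
Qed.

(** The probability that step [k] is taken; summed over [i < k] it is the mean number of steps, the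
    expected stopping time in Wald's identities. *)
Definition alive k := fine (P [set w | `|S k w| <= lam]).

Lemma wald_mean k y : (k <= n)%N -> \int[P]_w ip (S k w) y =
  \sum_(i < k) alive i * \int[P]_w ip (zeta i w) y.
Proof.
elim: k => [_|k IH kn].
  rewrite big_ord0 /S /=; under eq_Rintegral do rewrite (ip0l ipH).
  exact: Rintegral_prob_cst.
rewrite big_ord_recr /= -IH; last exact: ltnW.
apply: (@Rintegral_ip_stop_step _ _ _ ipH sepH _ _ P _ _ (lam + del) del) => //.
- by apply: rS; exact: ltnW.
- exact: rzeta.
- exact: indepS.
- by move=> w; apply: stopped_bound; exact: ltnW.
- by move=> w; exact: zeta_del.
Qed.

Lemma wald_square (c : nat -> R) k : (forall i, (i < n)%N -> 0 <= c i) ->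
  (forall i y, (i < n)%N -> `|\int[P]_w ip (zeta i w) y| <= c i * `|y|) ->
  (k <= n)%N ->
  `|\int[P]_w `|S k w| ^+ 2 - \sum_(i < k) alive i * \int[P]_w `|zeta i w| ^+ 2| <=
  2 * lam * \sum_(i < k) c i.
Proof.
move=> c0 hc; elim: k => [_|k IH kn].
  rewrite !big_ord0 /S /=; under eq_Rintegral do rewrite normr0 expr0n /=.
  by rewrite Rintegral_prob_cst subrr normr0 mulr0.
rewrite !big_ord_recr /= mulrDr.
have := IH (ltnW kn).
have := @Rintegral_norm_stop_step _ _ _ ipH sepH _ _ P (S k) (zeta k) (lam + del)
  del lam (rS (ltnW kn)) (rzeta kn) (indepS kn) _ _ lam0 (c k) (c0 _ kn) _.
move/(_ (fun w => stopped_bound w (ltnW kn)) (fun w => zeta_del w kn) (fun y => hc k y kn)).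
rewrite -/(alive k) => h1 h2; rewrite [leRHS]addrC.
set a := \int[P]_w `|S k w| ^+ 2 in h1 h2 *; set b := \int[P]_w (`|_| ^+ 2).
set e := \sum_(i < k) _ in h2 *; set f := alive k * _ in h1 *.
have -> : b - (e + f) = (b - (a + f)) + (a - e) by ring.
by rewrite (le_trans (ler_normD _ _))// lerD.
Qed.

End wald.

(** * Truncation, and expectations under equality of laws *)

Section truncation.
Context {R : realType} {H : normedModType R}.
Local Notation borelH := (g_sigma_algebraType (@open H)).

(** The cut is on [q x] and not on the norm of [B x], so that a single event of small paths makes
    the truncation inactive for all [B] dominated by [q]. *)
Definition truncated (q : H -> R) (del : R) (B : H -> H) (x : H) : H :=
  if q x <= del then B x else 0.

Lemma norm_truncated_le q del B x : (forall x, `|B x| <= q x) -> 0 <= del ->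
  `|truncated q del B x| <= del.
Proof.
move=> Bq d0; rewrite /truncated; case: ifPn => [|_]; last by rewrite normr0.
exact: le_trans.
Qed.

Lemma truncated_borel q del B : continuous q -> continuous B ->
  forall C, borel_sets C -> borel_sets (truncated q del B @^-1` C).
Proof.
move=> cq cB; have rid : rvH (id : borelH -> H) by apply/rvH_measurable_fun.
have mq : measurable [set x : borelH | q x <= del].
  rewrite -[X in measurable X]setTI; apply: measurable_fun_le => //.
  exact: (rvH_continuous_real cq rid).
have := rvH_ifte mq (rvH_comp cB rid) (rvH_cst (0 : H)).
congr (rvH _); apply/funext => x; rewrite /truncated; congr (if _ then _ else _).
by apply/idP/idP => [/set_mem|/mem_set].
Qed.

Context {d : measure_display} {Om : measurableType d} (P : probability Om R).

Lemma Rintegral_same_law (X Y : Om -> H) (f : borelH -> R) :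
  rvH X -> rvH Y ->
  (forall C, borel_sets C -> P (X @^-1` C) = P (Y @^-1` C)) ->
  bmeas f -> \int[P]_w f (X w) = \int[P]_w f (Y w).
Proof.
move=> rX rY XY bf; have [mf [M fM]] := bf.
have mfE : measurable_fun setT (EFin \o f) by exact/measurable_EFinP.
have key (W : Om -> H) (rW : rvH W) :
    measurable_fun setT (W : Om -> borelH) /\
    P.-integrable ((W : Om -> borelH) @^-1` setT) ((EFin \o f) \o W).
  have mW : measurable_fun setT (W : Om -> borelH) by apply/rvH_measurable_fun.
  split=> //; apply: (@bmeas_integrable _ _ _ P (f \o W)); split.
    exact: measurableT_comp mf mW.
  by exists M => w; exact: fM.
have [mX iX] := key X rX; have [mY iY] := key Y rY.
rewrite /Rintegral; congr fine.
rewrite -[LHS](integral_pushforward mX mfE iX measurableT).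
rewrite -[RHS](integral_pushforward mY mfE iY measurableT).
pose Xf : {mfun Om >-> borelH} := HB.pack (X : Om -> borelH) (isMeasurableFun.Build _ _ _ _ _ mX).
pose Yf : {mfun Om >-> borelH} := HB.pack (Y : Om -> borelH) (isMeasurableFun.Build _ _ _ _ _ mY).
apply: (@eq_measure_integral _ _ _ _ (pushforward P Yf) (pushforward P Xf)).
by move=> A mA _; exact: XY.
Qed.

End truncation.

(** * Moments of truncated increments *)

Section small_increments.
Context {R : realType} {H : normedModType R} (ip : H -> H -> R).
Hypothesis ipH : is_inner_product ip.
Hypothesis sepH : exists u : nat -> H, dense (range u).
Context {d : measure_display} {Om : measurableType d} (P : probability Om R).
Local Notation borelH := (g_sigma_algebraType (@open H)).

Variables (Z : R -> Om -> H) (t : R).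
Hypothesis t0 : 0 < t.
Hypothesis rZ : forall s, 0 <= s -> rvH (Z s).
Hypothesis Z0 : forall w, Z 0 w = 0.
Hypothesis iZ : forall (n : nat) (r : nat -> R), 0 <= r 0%N ->
  (forall k, (k < n)%N -> r k < r k.+1) ->
  indep_family P n (fun k w => Z (r k.+1) w - Z (r k) w).
Hypothesis sZ : forall s u B, 0 <= s -> s <= u -> borel_sets B ->
  P ((fun w => Z u w - Z s w) @^-1` B) = P (Z (u - s) @^-1` B).

Variables (q : H -> R) (del : R) (Bad : set Om).
Hypothesis cq : continuous q.
Hypothesis qB : forall x y, q (x - y) <= q x + q y.
Hypothesis del0 : 0 < del.
Hypothesis mBad : measurable Bad.
Hypothesis Bad_half : fine (P Bad) <= 1 / 2.
Hypothesis Bad_q : forall w, ~ Bad w -> forall s, 0 <= s <= t -> q (Z s w) <= del / 2.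

(** [q] stands for [osc L], and [Bad] for the event that a path value on [[0, t]] oscillates too
    much. *)
Definition controlled (B : H -> H) :=
  [/\ linear_op B, continuous B & forall x, `|B x| <= q x].

Lemma linear_opB (B : H -> H) x y : linear_op B -> B (x - y) = B x - B y.
Proof.
by move=> lB; have := lB (-1) y x; rewrite scaleN1r addrC => ->; rewrite scaleN1r addrC.
Qed.

Lemma linear_op0 (B : H -> H) : linear_op B -> B 0 = 0.
Proof. by move=> lB; have := linear_opB 0 0 lB; rewrite !subrr. Qed.

Section increments.
Variables (n : nat) (r : nat -> R) (B : nat -> H -> H).
Hypotheses (r0 : r 0%N = 0) (rt : r n <= t)
  (rS : forall k, (k < n)%N -> r k < r k.+1)
  (cB : forall k, (k < n)%N -> controlled (B k)).

Let xi k w := Z (r k.+1) w - Z (r k) w.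
Definition tincr k w := truncated q del (B k) (xi k w).

Lemma partition_bounds k : (k <= n)%N -> 0 <= r k <= t.
Proof.
move=> kn; apply/andP; split.
  elim: k kn => [|k IH kn]; first by rewrite r0.
  by rewrite (le_trans (IH (ltnW kn)))// ltW// rS.
apply: le_trans rt; elim: n kn rS => [|m IH]; first by rewrite leqn0 => /eqP ->.
rewrite leq_eqVlt => /predU1P[->//|]; rewrite ltnS => km rS'.
by rewrite (le_trans (IH km _))// ?ltW ?rS'// => i im; apply: rS'; exact: ltnW.
Qed.

Lemma rvH_increment k : (k < n)%N -> rvH (xi k).
Proof.
move=> kn; apply: rvHB => //; apply: rZ.
  by have /andP[] := partition_bounds kn.
by have /andP[] := partition_bounds (ltnW kn).
Qed.

Lemma rvH_tincr k : (k < n)%N -> rvH (tincr k).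
Proof.
move=> kn C mC; have [_ cBk _] := cB kn.
exact: (rvH_increment kn (truncated_borel del cq cBk mC)).
Qed.

Lemma tincr_bound k w : (k < n)%N -> `|tincr k w| <= del.
Proof. by move=> kn; have [_ _ Bq] := cB kn; apply: norm_truncated_le => //; exact: ltW. Qed.

Lemma indep_tincr : indep_family P n tincr.
Proof.
move=> C mC.
pose C' i := if (i < n)%N then truncated q del (B i) @^-1` C i else setT.
have mC' i : borel_sets (C' i).
  rewrite /C'; case: ifPn => ni; last exact: borel_setT.
  by have [_ cBk _] := cB ni; exact: truncated_borel.
have -> : \bigcap_(i < n) (tincr i @^-1` C i) = \bigcap_(i < n) (xi i @^-1` C' i).
  by apply: eq_bigcapr => i /= ni; rewrite /C' ni.
rewrite (iZ _ rS mC') ?r0//; apply: eq_bigr => i _.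
by rewrite /C' ltn_ord.
Qed.

(** This is why path values are kept below [del / 2]: an increment is a difference of two of
    them. *)
Lemma tincr_good w k : ~ Bad w -> (k < n)%N ->
  tincr k w = B k (Z (r k.+1) w - Z (r k) w).
Proof.
move=> nB kn; rewrite /tincr /truncated ifT// (le_trans (qB _ _))//.
rewrite [leRHS](splitr del) lerD//.
  by apply: (Bad_q nB); exact: partition_bounds.
by apply: (Bad_q nB); apply: partition_bounds; exact: ltnW.
Qed.

Lemma tincr_law k y : (k < n)%N ->
  \int[P]_w ip (tincr k w) y =
    \int[P]_w ip (truncated q del (B k) (Z (r k.+1 - r k) w)) y /\
  \int[P]_w `|tincr k w| ^+ 2 =
    \int[P]_w `|truncated q del (B k) (Z (r k.+1 - r k) w)| ^+ 2.
Proof.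
move=> kn; have [lB cBk Bq] := cB kn.
have /andP[rk0 _] := partition_bounds (ltnW kn).
have rkS : r k <= r k.+1 by exact/ltW/rS.
have rid : rvH (truncated q del (B k) : borelH -> H).
  by move=> C mC; exact: truncated_borel.
have tb x : `|truncated q del (B k) x| <= del by apply: norm_truncated_le => //; exact: ltW.
have rh : rvH (Z (r k.+1 - r k)) by apply: rZ; rewrite subr_ge0.
split.
  apply: (@Rintegral_same_law _ _ _ _ P _ _ (fun x => ip (truncated q del (B k) x) y)) => //.
  - exact: rvH_increment.
  - by move=> C mC; exact: sZ.
  - by apply: (bmeas_ip ipH sepH rid (rvH_cst y) tb) => w; exact: lexx.
apply: (@Rintegral_same_law _ _ _ _ P _ _ (fun x => `|truncated q del (B k) x| ^+ 2)) => //.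
- exact: rvH_increment.
- by move=> C mC; exact: sZ.
- exact: bmeas_sqr_norm rid tb.
Qed.

End increments.

(* Optional stopping at the first exit of the partial sums from the ball of
   radius [del]: since the stopped sums stay below [2 * del] and survive with
   probability at least one half, the common mean and second moment of the
   [n] identically distributed summands are of order [1 / n]. *)
Lemma truncated_moments (B : H -> H) h : controlled B -> 0 < h <= t ->
  (forall y, `|\int[P]_w ip (truncated q del B (Z h w)) y| <=
     8 * del * (h / t) * `|y|) /\
  \int[P]_w `|truncated q del B (Z h w)| ^+ 2 <= 48 * del ^+ 2 * (h / t).
Proof.
move=> cB /andP[h0 ht].
(* As many copies of the increment as fit into [[0, t]]. Since [h <= t], [n] is positive and
   rounding down costs at most the factor 2 in [tn]. *)
pose n := Num.truncn (t / h).
have th0 : 0 <= t / h by rewrite divr_ge0// ltW.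
have /andP[nth thn] : n%:R <= t / h < n.+1%:R by exact: truncn_itv.
have n1 : (0 < n)%N.
  by rewrite lt0n; apply/eqP => nE; move: thn; rewrite nE ltr_pdivrMr// mul1r ltNge ht.
have n0 : 0 < n%:R :> R by rewrite ltr0n.
have tn : n%:R^-1 <= 2 * (h / t).
  rewrite -[leRHS]invrK lef_pV2 ?posrE//; last by rewrite invr_gt0 mulr_gt0// divr_gt0.
  rewrite invfM invf_div mulrC ler_pdivrMr// (le_trans (ltW thn))//.
  by rewrite mulr_natr -addn1 natrD mulr2n lerD2l ler1n.
pose r k : R := k%:R * h.
have r0 : r 0%N = 0 by rewrite /r mul0r.
have rt : r n <= t by rewrite /r -ler_pdivlMr.
have rS k : (k < n)%N -> r k < r k.+1 by move=> _; rewrite /r ltr_pM2r// ltr_nat.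
have rE k : r k.+1 - r k = h by rewrite /r -natr1 mulrDl mul1r addrAC subrr add0r.
have cB' k : (k < n)%N -> controlled ((fun=> B) k) by [].
pose zeta := tincr r (fun=> B).
have iz : indep_family P n zeta by exact: indep_tincr.
have rz i : (i < n)%N -> rvH (zeta i) by exact: rvH_tincr.
have zb i w : (i < n)%N -> `|zeta i w| <= del by move=> ni; exact: (tincr_bound _ cB').
have d0 : 0 <= del by exact: ltW.
have [lB _ Bq] := cB.
have Sgood w k : ~ Bad w -> (k <= n)%N -> \sum_(i < k) zeta i w = B (Z (r k) w).
  move=> nB; elim: k => [_|k IH kn]; first by rewrite big_ord0 r0 Z0 linear_op0.
  rewrite big_ord_recr /= IH; last exact: ltnW.
  by rewrite /zeta (tincr_good (fun=> B) r0 rt rS nB kn) linear_opB// addrC subrK.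
have Sdel w k : ~ Bad w -> (k <= n)%N -> `|\sum_(i < k) zeta i w| <= del.
  move=> nB kn; rewrite Sgood// (le_trans (Bq _))//.
  rewrite (le_trans (Bad_q nB (partition_bounds r0 rt rS kn)))//.
  by rewrite ler_pdivrMr// ler_peMr// ler1n.
(* Off [Bad] the truncations are inactive and the partial sums are the values [B (Z (k * h))], of
   norm at most [del]: the walk never stops. *)
have alive_half k : (k <= n)%N -> 1 / 2 <= alive P zeta del k.
  move=> kn; apply: (@le_trans _ _ (fine (P (~` Bad)))).
    by rewrite fine_prob_setC// lerBrDr (le_trans (lerD (lexx _) Bad_half))//; lra.
  apply: fine_prob_le; first exact: measurableC.
    apply: measurable_norm_le; apply: rvH_stopped => // i ik.
    by apply: rz; exact: leq_trans kn.
  move=> w nB /=; rewrite sum_stopped; first exact: Sdel.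
  by move=> j jk; apply: Sdel => //; exact: leq_trans (ltnW jk) kn.
pose A := \sum_(i < n) alive P zeta del i.
have An : n%:R / 2 <= A.
  have -> : n%:R / 2 = \sum_(i < n) (1 / 2 : R).
    by rewrite mulr_natl sumr_const card_ord div1r.
  by apply: ler_sum => i _; apply: alive_half; exact: ltnW.
have A0 : 0 < A by rewrite (lt_le_trans _ An)// divr_gt0.
pose mu y := \int[P]_w ip (truncated q del B (Z h w)) y.
pose v := \int[P]_w `|truncated q del B (Z h w)| ^+ 2.
have zmu i y : (i < n)%N -> \int[P]_w ip (zeta i w) y = mu y.
  by move=> ni; have [-> _] := tincr_law r0 rt rS cB' y ni; rewrite rE.
have zv i : (i < n)%N -> \int[P]_w `|zeta i w| ^+ 2 = v.
  by move=> ni; have [_ ->] := tincr_law r0 rt rS cB' 0 ni; rewrite rE.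
have Sb w : `|stopped del zeta n w| <= del + del by exact: (@stopped_bound _ _ _ _ n).
have rSn : rvH (stopped del zeta n) by apply: rvH_stopped.
(* Wald's first identity equates [A * mu y] with the mean of a pairing bounded by [2 * del] times
   the norm of [y], while [A] is at least [n / 2]. *)
have mu_n y : `|mu y| <= 4 * del / n%:R * `|y|.
  have := wald_mean ipH sepH d0 d0 iz rz zb y (leqnn n).
  have -> : \sum_(i < n) alive P zeta del i * \int[P]_w ip (zeta i w) y = A * mu y.
    by rewrite mulr_suml; apply: eq_bigr => i _; rewrite zmu.
  move=> E.
  have : `|A * mu y| <= (del + del) * `|y|.
    rewrite -E; apply: normr_Rintegral_le.
      by apply: measurable_ip => //; exact: rvH_cst.
    by move=> w; rewrite (le_trans (normr_ip_le ipH _ _))// ler_wpM2r.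
  rewrite normrM gtr0_norm// => Amu.
  have : n%:R / 2 * `|mu y| <= (del + del) * `|y|.
    by rewrite (le_trans _ Amu)// ler_wpM2r.
  move=> hmu; rewrite -(ler_pM2l n0).
  have -> : n%:R * (4 * del / n%:R * `|y|) = 4 * del * `|y| by field; rewrite gt_eqF.
  lra.
(* 24 is 2 * (4 + 8): [(2 * del) ^ 2] bounds the second moment of the stopped sum,
   [2 * del * (4 * del)] is the error in Wald's second identity, and [A] is at least [n / 2]. *)
have vn : v <= 24 * del ^+ 2 / n%:R.
  have c0 : 0 <= 4 * del / n%:R by rewrite divr_ge0// mulr_ge0.
  have hc i y : (i < n)%N -> `|\int[P]_w ip (zeta i w) y| <= 4 * del / n%:R * `|y|.
    by move=> ni; rewrite zmu.
  have := wald_square ipH sepH d0 d0 iz rz zb (fun _ _ => c0) hc (leqnn n).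
  have -> : \sum_(i < n) alive P zeta del i * \int[P]_w `|zeta i w| ^+ 2 = A * v.
    by rewrite mulr_suml; apply: eq_bigr => i _; rewrite zv.
  have -> : \sum_(i < n) 4 * del / n%:R = 4 * del.
    by rewrite sumr_const card_ord -[LHS]mulr_natr divfK// gt_eqF.
  have : `|\int[P]_w `|stopped del zeta n w| ^+ 2| <= (del + del) ^+ 2.
    apply: normr_Rintegral_le; first by apply: measurable_funX; exact: rvH_norm.
    by move=> w; rewrite ger0_norm ?sqr_ge0// lerXn2r ?nnegrE ?addr_ge0.
  have v0 : 0 <= v by apply: Rintegral_ge0 => w _; exact: sqr_ge0.
  have : n%:R / 2 * v <= A * v by rewrite ler_wpM2r.
  rewrite !ler_norml ler_pdivlMr// => ? /andP[_ ?] /andP[? _]; nra.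
split=> [y|].
  rewrite (le_trans (mu_n y))// ler_wpM2r//.
  have -> : 8 * del * (h / t) = 4 * del * (2 * (h / t)) by ring.
  by rewrite ler_wpM2l// mulr_ge0.
rewrite (le_trans vn)//.
have -> : 48 * del ^+ 2 * (h / t) = 24 * del ^+ 2 * (2 * (h / t)) by ring.
by rewrite ler_wpM2l// mulr_ge0// sqr_ge0.
Qed.

(** The moment bounds are linear in the length of the increment, so over any partition they add up
    to a constant that sees neither mesh nor number of points. Stopping at [lam] holds the cross
    terms at [2 * lam * (8 * del)], and Chebyshev's inequality concludes. *)
Lemma controlled_sum_small (m : nat) (r : nat -> R) (B : nat -> H -> H) (lam : R) :
  0 < lam -> r 0%N = 0 -> r m = t ->
  (forall k, (k < m)%N -> r k < r k.+1) ->
  (forall k, (k < m)%N -> controlled (B k)) ->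
  fine (P [set w | lam < `|\sum_(k < m) B k (Z (r k.+1) w - Z (r k) w)|]) <=
    fine (P Bad) + (48 * del ^+ 2 + 16 * lam * del) / lam ^+ 2.
Proof.
move=> lam0 r0 rm rS cB.
have rt : r m <= t by rewrite rm.
have d0 : 0 <= del by exact: ltW.
pose zeta := tincr r B.
have iz : indep_family P m zeta by exact: indep_tincr.
have rz i : (i < m)%N -> rvH (zeta i) by exact: rvH_tincr.
have zb i w : (i < m)%N -> `|zeta i w| <= del by move=> ni; exact: (tincr_bound _ cB).
have h_t i : (i < m)%N -> 0 < r i.+1 - r i <= t.
  move=> im; rewrite subr_gt0 rS//=.
  have /andP[? _] := partition_bounds r0 rt rS (ltnW im).
  by have /andP[_ ?] := partition_bounds r0 rt rS im; lra.
pose c i := 8 * del * ((r i.+1 - r i) / t).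
have c0 i : (i < m)%N -> 0 <= c i.
  move=> im; have /andP[/ltW hi _] := h_t i im.
  apply: mulr_ge0; first exact: mulr_ge0.
  by apply: divr_ge0 => //; exact: ltW.
have sumh : \sum_(i < m) (r i.+1 - r i) / t = 1.
  rewrite -mulr_suml -(big_mkord xpredT (fun i => r i.+1 - r i)).
  by rewrite telescope_sumr// r0 rm subr0 divff// gt_eqF.
have rSm : rvH (stopped lam zeta m) by apply: rvH_stopped.
pose E2 := \int[P]_w `|stopped lam zeta m w| ^+ 2.
have E2le : E2 <= 48 * del ^+ 2 + 16 * lam * del.
  have hc i y : (i < m)%N -> `|\int[P]_w ip (zeta i w) y| <= c i * `|y|.
    move=> im; have [-> _] := tincr_law r0 rt rS cB y im.
    by have [/(_ y)] := truncated_moments (cB i im) (h_t i im).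
  have := wald_square ipH sepH (ltW lam0) d0 iz rz zb c0 hc (leqnn m).
  have -> : \sum_(i < m) c i = 8 * del by rewrite -mulr_sumr sumh mulr1.
  have : \sum_(i < m) alive P zeta lam i * \int[P]_w `|zeta i w| ^+ 2 <= 48 * del ^+ 2.
    have -> : 48 * del ^+ 2 = \sum_(i < m) 48 * del ^+ 2 * ((r i.+1 - r i) / t).
      by rewrite -mulr_sumr sumh mulr1.
    apply: ler_sum => i _.
    have im := ltn_ord i.
    have [_ ->] := tincr_law r0 rt rS cB 0 im.
    have [_ h] := truncated_moments (cB i im) (h_t i im).
    rewrite (le_trans _ h)// ler_piMl//.
      by apply: Rintegral_ge0 => w _; exact: sqr_ge0.
    apply: fine_prob_le1; apply: measurable_norm_le; apply: rvH_stopped => // j ji.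
    by apply: rz; exact: ltn_trans im.
  rewrite -/E2 ler_norml => ? /andP[_ ?]; lra.
pose Out := [set w | lam < `|stopped lam zeta m w|].
have mOut : measurable Out by apply: measurable_set_ltr => //; exact: rvH_norm.
have rsum : rvH (fun w => \sum_(k < m) B k (Z (r k.+1) w - Z (r k) w)).
  apply: (rvH_sum sepH (F := fun k w => B k (Z (r k.+1) w - Z (r k) w))) => k km.
  have [_ cBk _] := cB k km.
  exact: (rvH_comp cBk (rvH_increment r0 rt rS km)).
apply: (@le_trans _ _ (fine (P (Bad `|` Out)))).
  apply: fine_prob_le; [|exact: measurableU|].
    by apply: measurable_set_ltr => //; exact: rvH_norm.
  (* Off [Bad] and [Out] nothing was truncated or stopped, so the stopped sum is the sum itself. *)
  move=> w /= lw; have [|nB] := pselect (Bad w); first by left.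
  right; rewrite /Out /= ltNge; apply/negP => Sl.
  move: lw; rewrite ltNge => /negP; apply.
  rewrite (_ : \sum_(_ < m) _ = stopped lam zeta m w)// (stopped_sum Sl).
  by apply: eq_bigr => k _; rewrite -(tincr_good B r0 rt rS nB).
rewrite (le_trans (fine_probU P mBad mOut))// lerD2l.
rewrite ler_pdivlMr ?exprn_gt0// (le_trans _ E2le)//.
rewrite -(Rintegral_indicE P mOut) mulrC -RintegralZl_bmeas; last exact: bmeas_indic.
apply: le_Rintegral_bmeas.
- by apply: bmeasM; [exact: bmeas_cst|exact: bmeas_indic].
- apply: (@bmeas_sqr_norm _ _ _ _ _ (lam + del)) => // w.
  by apply: (@stopped_bound _ _ _ _ m) => //; exact: ltW.
move=> w; rewrite indicE; case: (boolP (w \in Out)) => [/set_mem wO|_].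
  by rewrite mulr1 lerXn2r ?nnegrE//; exact: ltW.
by rewrite mulr0 sqr_ge0.
Qed.

End small_increments.

(** * Oscillation along cadlag paths *)

Section oscillation.
Context {R : realType} {H : normedModType R}.
Variables (Rs : R -> H -> H) (t M : R).
Hypothesis t0 : 0 < t.
Hypothesis Rlin : forall s, 0 <= s <= t -> linear_op (Rs s).
Hypothesis RM : forall s x, 0 <= s <= t -> `|Rs s x| <= M * `|x|.
Hypothesis Rcont : forall x, {within `[0, +oo[, continuous (fun s => Rs s x)}.

Let osc_set (L : nat) (x : H) : set R :=
  [set y | exists u v, [/\ 0 <= u <= t, 0 <= v <= t, `|u - v| <= t / 2 ^+ L &
     y = `|Rs u x - Rs v x|]].

Definition osc (L : nat) (x : H) : R := sup (osc_set L x).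

Let tL0 L : 0 <= t / 2 ^+ L.
Proof. by rewrite divr_ge0// ?exprn_ge0// ltW. Qed.

Let osc_set0 L x : osc_set L x 0.
Proof.
have h00 : 0 <= (0 : R) <= t by apply/andP; split; [exact: lexx|exact: ltW].
by exists 0, 0; split=> //; rewrite !subrr normr0.
Qed.

Let osc_set_ub L x : ubound (osc_set L x) (2 * M * `|x|).
Proof.
move=> _ [u [v [hu hv _ ->]]]; rewrite (le_trans (ler_normB _ _))//.
by rewrite -mulrA mulr_natl mulr2n lerD// RM.
Qed.

Lemma osc_ge L u v x : 0 <= u <= t -> 0 <= v <= t -> `|u - v| <= t / 2 ^+ L ->
  `|Rs u x - Rs v x| <= osc L x.
Proof.
move=> hu hv uv; apply: sup_upper_bound; last by exists u, v.
by split; [exists 0; exact: osc_set0|exists (2 * M * `|x|); exact: osc_set_ub].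
Qed.

Lemma osc_le L x c : (forall u v, 0 <= u <= t -> 0 <= v <= t ->
  `|u - v| <= t / 2 ^+ L -> `|Rs u x - Rs v x| <= c) -> osc L x <= c.
Proof.
move=> h; apply: ge_sup; first by exists 0; exact: osc_set0.
by move=> _ [u [v [hu hv uv ->]]]; exact: h.
Qed.

Lemma osc_le_norm L x : osc L x <= 2 * M * `|x|.
Proof. by apply: osc_le => u v hu hv uv; apply: (@osc_set_ub L); exists u, v. Qed.

Lemma oscB L x y : osc L (x - y) <= osc L x + osc L y.
Proof.
apply: osc_le => u v hu hv uv; rewrite (linear_opB x y (Rlin hu)) (linear_opB x y (Rlin hv)).
rewrite opprB [Rs v y - _]addrC addrACA [- Rs u y + _]addrC -[X in _ + X]opprB.
by rewrite (le_trans (ler_normB _ _))// lerD// osc_ge.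
Qed.

Lemma osc_lipschitz L x y : osc L x <= osc L y + 2 * M * `|x - y|.
Proof.
have := oscB L (x - y) (- y); rewrite opprK subrK => /le_trans; apply.
rewrite addrC lerD//; last exact: osc_le_norm.
rewrite -(sub0r y) (le_trans (oscB _ _ _))// gerDr (le_trans (osc_le_norm _ _))//.
by rewrite normr0 mulr0.
Qed.

Lemma osc_continuous L : continuous (osc L).
Proof.
apply: (@lipschitz_continuous _ _ _ (2 * M)) => x y.
rewrite ler_norml lerNl opprB !lerBlDl osc_lipschitz andbT distrC.
exact: osc_lipschitz.
Qed.

Lemma osc_decr L L' x : (L <= L')%N -> osc L' x <= osc L x.
Proof.
move=> LL'; apply: osc_le => u v hu hv uv; apply: osc_ge => //.
rewrite (le_trans uv)// ler_pM2l// lef_pV2 ?posrE ?exprn_gt0//.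
by rewrite ler_weXn2l// ler1n.
Qed.

Lemma small_mesh (e : R) : 0 < e -> exists L0, forall L, (L0 <= L)%N -> t / 2 ^+ L < e.
Proof.
move=> e0.
have et : 0 < e / t by rewrite divr_gt0.
have [N _ hN] := near_infty_natSinv_expn_lt (PosNum et).
exists N => L /hN /=; rewrite ltr_pdivlMr// mulrC mulrA mulr1; exact.
Qed.

(** Uniform continuity of the orbit [s |-> Rs s x] on the compact interval, obtained from the
    covering form of compactness with [L] as parameter. *)
Lemma osc_cvg0 x e : 0 < e -> exists L0, forall L, (L0 <= L)%N -> osc L x <= e.
Proof.
move=> e0.
have := @segment_compact R 0 t; rewrite compact_near_coveringP.
move=> /(_ nat \oo (fun L s => forall u, 0 <= u <= t -> 0 <= s <= t ->
  `|u - s| <= t / 2 ^+ L -> `|Rs u x - Rs s x| <= e) _)[].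
  move=> s; rewrite /= in_itv /= => /andP[s0 st].
  have : \forall u \near within `[0, +oo[ (nbhs s), `|Rs s x - Rs u x| < e / 2.
    have := Rcont (x := x); rewrite continuous_subspace_in => /(_ s).
    rewrite inE /= in_itv /= s0 => /(_ isT) h.
    have /cvgrPdist_lt := h; move=> /(_ (e / 2)); rewrite divr_gt0// => /(_ isT).
    by rewrite /prop_near1 nbhs_subspace_in//= in_itv /= s0.
  move=> /nbhs_normP[eta /= eta0 he].
  have eta2 : 0 < eta / 2 by rewrite divr_gt0.
  have [L0 hL0] := small_mesh eta2.
  exists ([set s' | `|s - s'| < eta / 2], [set L | (L0 <= L)%N]) => /=.
    split; first by apply/nbhs_normP; exists (eta / 2).
    by exists L0.
  move=> [s' L] /= [ss' LL] u hu hs' us'.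
  have E (z : R) : 0 <= z -> `|s - z| < eta -> `|Rs s x - Rs z x| < e / 2.
    by move=> z0 sz; apply: he => //=; rewrite in_itv /= z0.
  have h1 : `|Rs s x - Rs s' x| < e / 2.
    apply: E; first by case/andP: hs'.
    by rewrite (lt_trans ss')// ltr_pdivrMr// ltr_pMr// ltr1n.
  have h2 : `|Rs s x - Rs u x| < e / 2.
    apply: E; first by case/andP: hu.
    rewrite (le_lt_trans (ler_distD s' _ _))// [ltRHS](splitr eta) ltrD//.
    by rewrite distrC (le_lt_trans us')// hL0.
  rewrite (le_trans (ler_distD (Rs s x) _ _))// [leRHS](splitr e) lerD//; last exact: ltW.
  by rewrite distrC ltW.
move=> L0 _ hL0; exists L0 => L LL; apply: osc_le => u v hu hv uv.
by apply: (hL0 L LL v) => //; rewrite /= in_itv.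
Qed.

(** Smallness at [x] spreads to a ball around [x], the same for all large [L], because the Lipschitz
    constant of [osc L] does not depend on [L]. *)
Lemma osc_local x e : 0 < e -> exists eta L0, 0 < eta /\
  forall y L, `|x - y| < eta -> (L0 <= L)%N -> osc L y <= e.
Proof.
move=> e0; have e2 : 0 < e / 2 by rewrite divr_gt0.
have [L0 hL0] := osc_cvg0 x e2.
have M0 : 0 < 2 * `|M| + 1 by rewrite ltr_wpDl.
exists (e / 2 / (2 * `|M| + 1)), L0; split=> [|y L xy LL]; first by rewrite divr_gt0.
rewrite (le_trans (osc_lipschitz _ _ x))// [leRHS](splitr e) lerD//; first exact: hL0.
move: xy; rewrite ltr_pdivlMr// distrC mulrC => /ltW; apply: le_trans.
rewrite ler_wpM2r// (@le_trans _ _ (2 * `|M|))//; last by rewrite lerDl.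
by rewrite ler_pM2l// ler_norm.
Qed.

(** Near each time the path is close to [f s] on the right and to the left limit on the left.
    Applying [osc_local] at these two points and covering [[0, t]] gives one level for the whole
    path. *)
Lemma osc_path (f : R -> H) e : 0 < e ->
  (forall s, 0 <= s -> f @ s^'+ --> f s /\
     (0 < s -> exists l : H, f @ s^'- --> l)) ->
  exists L0, forall L s, (L0 <= L)%N -> 0 <= s <= t -> osc L (f s) <= e.
Proof.
move=> e0 cad.
have := @segment_compact R 0 t; rewrite compact_near_coveringP.
move=> /(_ nat \oo (fun L s => 0 <= s <= t -> osc L (f s) <= e) _)[].
  move=> s; rewrite /= in_itv /= => /andP[s0 st].
  have [fr fl] := cad s s0.
  have [eta [L1 [eta0 h1]]] := osc_local (f s) e0.
  have A1 : nbhs s [set u | s < u -> `|f s - f u| < eta].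
    by have /cvgrPdist_lt/(_ _ eta0) := fr.
  have [L2 [A2 [nA2 h2]]] : exists L2 A2, nbhs s A2 /\
      forall u L, A2 u -> 0 <= u < s -> (L2 <= L)%N -> osc L (f u) <= e.
    have [s_gt0|s_le0] := ltP 0 s; last first.
      exists 0%N, setT; split; first exact: filterT.
      by move=> u L _ /andP[u0 us]; move: (le_lt_trans u0 us); rewrite ltNge s_le0.
    have [l fl'] := fl s_gt0.
    have [eta' [L2 [eta'0 h2]]] := osc_local l e0.
    exists L2, [set u | u < s -> `|l - f u| < eta']; split.
      by have /cvgrPdist_lt/(_ _ eta'0) := fl'.
    by move=> u L hu /andP[_ us] LL; apply: h2 => //; exact: hu.
  exists ([set u | s < u -> `|f s - f u| < eta] `&` A2, [set L | (maxn L1 L2 <= L)%N]) => /=.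
    by split; [exact: filterI|exists (maxn L1 L2)].
  move=> [u L] /= [[hu1 hu2]]; rewrite geq_max => /andP[LL1 LL2] /andP[u0 ut].
  have [us|su|->] := ltgtP u s.
  - by apply: h2 => //; rewrite u0.
  - by apply: h1 => //; exact: hu1.
  - by apply: h1 => //; rewrite subrr normr0.
move=> L0 _ hL0; exists L0 => L s LL hs.
by apply: (hL0 L LL s) => //; rewrite /= in_itv.
Qed.

(** * Exceptional events of large oscillation *)

Section bad_events.
Context {d : measure_display} {Om : measurableType d} (P : probability Om R).
Variable Z : R -> Om -> H.
Hypothesis rZ : forall s, 0 <= s -> rvH (Z s).
Hypothesis cadZ : forall w s, 0 <= s ->
  (fun u => Z u w) @ s^'+ --> Z s w /\
  (0 < s -> exists l : H, (fun u => Z u w) @ s^'- --> l).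

Definition dyadic j k : R := t * (k%:R / 2 ^+ j).

Lemma dyadic_ge0 j k : 0 <= dyadic j k.
Proof. by rewrite mulr_ge0 ?divr_ge0 ?exprn_ge0// ltW. Qed.

Lemma dyadic_dense s e : 0 <= s < t -> 0 < e ->
  exists j k, (k <= 2 ^ j)%N /\ s < dyadic j k < s + e.
Proof.
move=> /andP[s0 st] e0; have [j /(_ j (leqnn j)) hj] := small_mesh e0.
have tj : 0 < t / 2 ^+ j by rewrite divr_gt0// exprn_gt0.
have x0 : 0 <= s / (t / 2 ^+ j) by rewrite divr_ge0.
pose k := Num.truncn (s / (t / 2 ^+ j)).
have /andP[k1 k2] : k%:R <= s / (t / 2 ^+ j) < k.+1%:R by exact: truncn_itv.
have dE i : dyadic j i = i%:R * (t / 2 ^+ j) by rewrite /dyadic mulrCA.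
exists j, k.+1; split; last first.
  rewrite dE -ltr_pdivrMr// k2 /= -natr1 mulrDl mul1r ler_ltD//.
  by rewrite -ler_pdivlMr.
rewrite -(ltr_nat R) natrX (le_lt_trans k1)// ltr_pdivrMr//.
by rewrite mulrC divfK// gt_eqF// exprn_gt0.
Qed.

(** Only dyadic times define [Bad L], which makes it measurable; right continuity carries the bound
    to all times. By [osc_path] each path leaves [Bad L] for large [L], so these decreasing events
    have empty intersection and small probability. *)
Lemma bad_event (e kappa : R) : 0 < e -> 0 < kappa -> exists L0, forall L, (L0 <= L)%N ->
  exists Bad : set Om, [/\ measurable Bad, fine (P Bad) <= kappa &
    forall w, ~ Bad w -> forall s : R, 0 <= s <= t -> osc L (Z s w) <= e].
Proof.
move=> e0 kappa0.
pose C L j k := if (k <= 2 ^ j)%N then [set w | e < osc L (Z (dyadic j k) w)] else set0.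
pose Bad L := \bigcup_j \bigcup_k C L j k.
have mBad L : measurable (Bad L).
  apply: bigcup_measurable => j _; apply: bigcup_measurable => k _.
  rewrite /C; case: ifP => // _; apply: measurable_set_ltr => //.
  by apply: rvH_continuous_real; [exact: osc_continuous|exact/rZ/dyadic_ge0].
have BadP L w : ~ Bad L w -> forall s : R, 0 <= s <= t -> osc L (Z s w) <= e.
  move=> nB.
  have nC j k : (k <= 2 ^ j)%N -> osc L (Z (dyadic j k) w) <= e.
    move=> kj; rewrite leNgt; apply/negP => h; apply: nB.
    by exists j => //; exists k => //; rewrite /C kj.
  (* The endpoint [t] has no times of [[0, t]] to its right, but it is itself the dyadic point
     [dyadic 0 1]. *)
  move=> s /andP[s0]; rewrite le_eqVlt => /predU1P[->|st].
    have := nC 0%N 1%N (leqnn _).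
    by rewrite /dyadic expr0 divr1 mulr1.
  rewrite leNgt; apply/negP => es.
  have cv : (fun u => osc L (Z u w)) @ s^'+ --> osc L (Z s w).
    by apply: continuous_cvg; [exact: osc_continuous|have [] := cadZ w s0].
  move/cvgrPdist_lt : cv => h.
  have := h (osc L (Z s w) - e); rewrite subr_gt0 => /(_ es).
  move=> /nbhs_normP[eta /= eta0 heta].
  have [j [k [kj /andP[sd dse]]]] : exists j k, (k <= 2 ^ j)%N /\ s < dyadic j k < s + eta.
    by apply: dyadic_dense; rewrite ?s0.
  have sde : `|s - dyadic j k| < eta by rewrite ltr_norml; apply/andP; split; lra.
  have := heta (dyadic j k) sde sd.
  move=> /ltr_normlW; rewrite ltrD2l ltrN2 ltNge; apply/negP; rewrite negbK.
  exact: nC.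
have decr : nonincreasing_seq Bad.
  move=> L L' LL'; apply/subsetPset => w [j _ [k _ h]]; exists j => //; exists k => //.
  move: h; rewrite /C; case: ifP => //= _ /lt_le_trans; apply; exact: osc_decr.
have cap0 : \bigcap_L Bad L = set0.
  apply/seteqP; split=> // w h.
  have [L0 hL0] := osc_path e0 (cadZ w).
  have [j _ [k _]] := h L0 I; rewrite /C; case: ifP => //= kj; rewrite ltNge => /negP; apply.
  apply: hL0 => //; rewrite dyadic_ge0 /dyadic ger_pMr// ler_pdivrMr ?exprn_gt0// mul1r.
  by rewrite -natrX ler_nat.
have : P \o Bad @ \oo --> P (\bigcap_L Bad L).
  apply: nonincreasing_cvg_mu => //.
  - by rewrite (le_lt_trans (probability_le1 P (mBad 0%N)))// ltry.
  - by rewrite cap0.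
rewrite cap0 measure0 => /fine_cvgP[_] /cvgrPdist_lt/(_ _ kappa0)[L0 _ hL0].
exists L0 => L LL; exists (Bad L); split=> //; last exact: BadP.
have := hL0 L LL; rewrite /= sub0r normrN => /ltr_normlW; exact: ltW.
Qed.

End bad_events.
End oscillation.

(** * Convergence in probability *)

Section convergence_in_probability.
Context {R : realType} {H : completeNormedModType R}.
Hypothesis sepH : exists u : nat -> H, dense (range u).
Context {d : measure_display} {Om : measurableType d} (P : probability Om R).
Implicit Types X Y W : Om -> H.

(** The condition [far e X Y <= e], with one number for distance and probability, says that the Ky
    Fan distance of [X] and [Y] is at most [e]. *)
Definition far (e : R) X Y := fine (P [set w | e < `|X w - Y w|]).

Lemma measurable_far e X Y : rvH X -> rvH Y -> measurable [set w | e < `|X w - Y w|].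
Proof.
by move=> rX rY; apply: measurable_set_ltr => //; apply: rvH_norm; exact: rvHB.
Qed.

Lemma farC e X Y : far e X Y = far e Y X.
Proof.
by rewrite /far; congr (fine (P _)); apply/seteqP; split=> w /=; rewrite distrC.
Qed.

Lemma far_triangle a b X Y W : rvH X -> rvH Y -> rvH W ->
  far (a + b) X W <= far a X Y + far b Y W.
Proof.
move=> rX rY rW; have mXY := measurable_far a rX rY.
have mYW := measurable_far b rY rW.
apply: le_trans (fine_probU P mXY mYW).
apply: fine_prob_le; [exact: measurable_far|exact: measurableU|].
move=> w /= abw; have [XY|XY] := leP `|X w - Y w| a; last by left.
right; rewrite ltNge; apply/negP => YW.
have := ler_distD (Y w) (X w) (W w); rewrite leNgt; apply/negP; rewrite negbK.
by rewrite (le_lt_trans _ abw)// lerD.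
Qed.

Lemma far_le e e' X Y : rvH X -> rvH Y -> e <= e' -> far e' X Y <= far e X Y.
Proof.
move=> rX rY ee; apply: fine_prob_le; [exact: measurable_far..|].
by move=> w /=; exact: le_lt_trans.
Qed.

Lemma fine_prob_bigU n (A : nat -> set Om) : (forall i, (i < n)%N -> measurable (A i)) ->
  measurable (\big[setU/set0]_(i < n) A i) /\
  fine (P (\big[setU/set0]_(i < n) A i)) <= \sum_(i < n) fine (P (A i)).
Proof.
elim: n => [_|n IH mA]; first by rewrite !big_ord0 measure0.
rewrite !big_ord_recr /=; have [|mU hU] := IH.
  by move=> i /ltnW; exact: mA.
split; first by apply: measurableU => //; exact: mA.
by rewrite (le_trans (fine_probU P mU (mA n _)))// lerD2r.
Qed.

Lemma sum_half_expn n m :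
  \sum_(i < m) 2^-1 ^+ (n + i) = 2 * 2^-1 ^+ n - 2 * 2^-1 ^+ (n + m) :> R.
Proof.
elim: m => [|m IH]; first by rewrite big_ord0 addn0 subrr.
by rewrite big_ord_recr/= IH addnS [2^-1 ^+ (n + m).+1]exprS; field.
Qed.

Lemma half_expn_small (e : R) : 0 < e -> exists i, 2^-1 ^+ i < e.
Proof.
move=> e0; have [N _ /(_ N (leqnn N)) /=] := near_infty_natSinv_expn_lt (PosNum e0).
by rewrite mul1r => h; exists N; rewrite exprVn.
Qed.

Section limit.
Variables (G : set (set Om)) (D : nat -> Om -> H).
Hypothesis Gm : <<s G >> `<=` measurable.
Hypothesis rD : forall n, rv_wrt <<s G >> (D n).
Hypothesis cauchyD : forall e : R, 0 < e -> exists n0, forall n m,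
  (n0 <= n)%N -> (n0 <= m)%N -> far e (D n) (D m) <= e.

Let rvD n : rvH (D n).
Proof. by move=> B mB; apply: Gm; exact: rD. Qed.

(** Completeness of convergence in probability, with a limit measurable for the possibly small
    sigma-algebra [<<s G>>]: this is what later makes the limits of separate blocks independent. *)
Lemma cauchy_in_prob_limit : exists Y, rv_wrt <<s G >> Y /\
  forall e : R, 0 < e -> exists n0, forall n, (n0 <= n)%N -> far e (D n) Y <= e.
Proof.
have h0 i : 0 < 2^-1 ^+ i :> R by rewrite exprn_gt0// invr_gt0.
have [N0 hN0] := choice (fun i => cauchyD (h0 i)).
(* Partial sums make the indices of the subsequence monotone while keeping them above [N0 i]. *)
pose N i := (\sum_(j < i.+1) N0 j)%N.
have NS i : (N i <= N i.+1)%N by rewrite /N [leqRHS]big_ord_recr leq_addr.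
have NN i : (N0 i <= N i)%N by rewrite /N [leqRHS]big_ord_recr leq_addl.
pose X i := D (N i).
pose A i := [set w | 2^-1 ^+ i < `|X i.+1 w - X i w|].
pose GT := g_sigma_algebraType G.
have rXG i : @rvH _ GT H (X i) by exact: rD.
have mAG i : @measurable _ GT (A i).
  apply: (@measurable_set_ltr _ _ GT) => //; apply: (@rvH_norm _ _ _ GT).
  exact: (@rvHB _ _ _ GT sepH).
have PA i : fine (P (A i)) <= 2^-1 ^+ i.
  by apply: hN0; [exact: leq_trans (NN i) (NS i)|exact: NN].
(* Borel-Cantelli by hand: off [C n] the steps from index [n] on are dominated by a geometric
   series, whose tail also bounds the probability of [C n]. *)
pose C n := \bigcup_(i in [set i | (n <= i)%N]) A i.
have mCG n : @measurable _ GT (C n) by exact: bigcup_measurable.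
have mC n : measurable (C n) by apply: Gm; exact: mCG.
have PC n : fine (P (C n)) <= 2 * 2^-1 ^+ n.
  pose Cm m := \big[setU/set0]_(i < m) A (n + i)%N.
  have mA i : measurable (A i) by apply: Gm; exact: mAG.
  have hCm m : measurable (Cm m) /\ fine (P (Cm m)) <= 2 * 2^-1 ^+ n.
    have [mU hU] := @fine_prob_bigU m (fun i => A (n + i)%N) (fun i _ => mA _).
    split=> //; rewrite (le_trans hU)//.
    apply: (@le_trans _ _ (\sum_(i < m) 2^-1 ^+ (n + i))); first exact: ler_sum.
    by rewrite sum_half_expn gerBl mulr_ge0// ltW.
  have CE : C n = \bigcup_m Cm m.
    apply/seteqP; split=> w.
      move=> [i /= ni Aw]; exists (i - n).+1 => //.
      by rewrite /Cm big_ord_recr /=; right; rewrite subnKC.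
    by move=> [m _]; rewrite /Cm -(bigcup_mkord m (fun i => A (n + i)%N)) => -[i /= _ Aw];
      exists (n + i)%N => //=; rewrite leq_addr.
  have : P \o Cm @ \oo --> P (\bigcup_m Cm m).
    apply: nondecreasing_cvg_mu.
    - by move=> m; have [] := hCm m.
    - by rewrite -CE.
    - apply/nondecreasing_seqP => m; apply/subsetPset => w Cw.
      by rewrite /Cm big_ord_recr /=; left.
  rewrite -CE -(fine_probE P (mC n)) => /fine_cvg cv.
  rewrite -(cvg_lim (@Rhausdorff R) cv); apply: limr_le; first exact: cvgP cv.
  by apply: nearW => m /=; have [] := hCm m.
have step w n i j : ~ C n w -> (n <= i)%N -> (i <= j)%N ->
    `|X j w - X i w| <= 2 * 2^-1 ^+ i - 2 * 2^-1 ^+ j.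
  move=> nC ni; elim: j => [|j IH].
    by rewrite leqn0 => /eqP ->; rewrite !subrr normr0.
  rewrite leq_eqVlt => /predU1P[->|]; first by rewrite !subrr normr0.
  rewrite ltnS => ij; have := IH ij.
  have : `|X j.+1 w - X j w| <= 2^-1 ^+ j.
    rewrite leNgt; apply/negP => h; apply: nC; exists j => //=.
    exact: leq_trans ij.
  have := ler_distD (X j w) (X j.+1 w) (X i w); rewrite [2^-1 ^+ j.+1]exprS.
  by move: (2^-1 ^+ j) (2^-1 ^+ i) => a b *; lra.
pose Gd := \bigcup_n ~` C n.
have mGd : @measurable _ GT Gd.
  by apply: bigcup_measurable => n _; exact: (@measurableC _ GT).
(* Since [Gd] belongs to [<<s G>>], putting 0 off it makes the limit exist everywhere without
   leaving [<<s G>>]. *)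
pose X' i w := if w \in Gd then X i w else 0.
have rX' i : @rvH _ GT H (X' i).
  by apply: (@rvH_ifte _ _ _ GT) => //; exact: rvH_cst.
have cvX' w : cvgn (X' ^~ w).
  have [Gw|nG] := pselect (Gd w); last first.
    rewrite (_ : X' ^~ w = fun=> 0); first exact: is_cvg_cst.
    by apply/funext => i; rewrite /X' ifF//; apply/negbTE/negP => /set_mem.
  have [n _ nC] := Gw.
  apply/cauchy_cvgP; apply: cauchy_exP => e e0.
  have e2 : 0 < e / 2 by rewrite divr_gt0.
  have [i hi] := half_expn_small e2.
  exists (X (maxn n i) w); exists (maxn n i) => // j /= ij.
  rewrite -ball_normE /= /X' ifT; last exact/mem_set.
  have := step w n (maxn n i) j nC (leq_maxl _ _) ij.
  rewrite distrC => /le_lt_trans; apply.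
  have := h0 j; have : 2^-1 ^+ maxn n i <= 2^-1 ^+ i :> R.
    by rewrite ler_wiXn2l ?invr_ge0 ?invf_le1 ?ler1n// leq_maxr.
  move: (2^-1 ^+ j) (2^-1 ^+ i) (2^-1 ^+ maxn n i) hi => a b c *; lra.
pose Y w := limn (X' ^~ w).
have rYG : @rvH _ GT H Y by apply: (@rvH_cvg _ _ _ GT sepH X') => // w; exact: cvX'.
have rY : rvH Y by move=> B mB; apply: Gm; exact: rYG.
have XY w i : ~ C i w -> `|X i w - Y w| <= 2 * 2^-1 ^+ i.
  move=> nC.
  have Gw : w \in Gd by apply/mem_set; exists i.
  have cv : (fun j => `|X i w - X' j w|) @ \oo --> `|X i w - Y w|.
    by apply: (@cvg_norm R H); apply: cvgB; [exact: cvg_cst|exact: cvX'].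
  rewrite -(cvg_lim (@Rhausdorff R) cv); apply: limr_le; first exact: cvgP cv.
  exists i => // j /= ij; rewrite /X' Gw distrC.
  rewrite (le_trans (step w i i j nC (leqnn i) ij))// gerBl mulr_ge0//.
exists Y; split=> // e e0.
have e3 : 0 < e / 3 by rewrite divr_gt0.
have [i hi] := half_expn_small e3.
exists (N i) => n Nn.
have mfar := measurable_far (2^-1 ^+ i) (rvD n) (rvD (N i)).
have [hU1 hU2] : measurable ([set w | 2^-1 ^+ i < `|D n w - D (N i) w|] `|` C i) /\
    fine (P ([set w | 2^-1 ^+ i < `|D n w - D (N i) w|] `|` C i)) <= e.
  split; first exact: measurableU.
  rewrite (le_trans (fine_probU P mfar (mC i)))//.
  have h1 : far (2^-1 ^+ i) (D n) (D (N i)) <= 2^-1 ^+ i.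
    by apply: hN0; [exact: leq_trans (NN i) Nn|exact: NN].
  have := lerD h1 (PC i); move/le_trans; apply.
  by move: (2^-1 ^+ i) hi => a *; lra.
apply: le_trans hU2; apply: fine_prob_le => //; first exact: measurable_far.
move=> w /= ew; have [h1|h1] := leP `|D n w - D (N i) w| (2^-1 ^+ i); last by left.
right; apply: contrapT => nC; move: ew; rewrite ltNge => /negP; apply.
rewrite (le_trans (ler_distD (X i w) _ _))//.
have := lerD h1 (XY w i nC); move/le_trans; apply.
by move: (2^-1 ^+ i) hi => a *; lra.
Qed.
End limit.
End convergence_in_probability.

(** * Riemann sums *)

Section riemann_sums.
Context {R : realType} {H : completeNormedModType R} (ip : H -> H -> R).
Hypothesis ipH : is_inner_product ip.
Hypothesis sepH : exists u : nat -> H, dense (range u).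
Variables (Rs : R -> H -> H) (t M : R).
Hypothesis t0 : 0 < t.
Hypothesis Rlin : forall s, 0 <= s <= t -> linear_op (Rs s).
Hypothesis RM : forall s x, 0 <= s <= t -> `|Rs s x| <= M * `|x|.
Hypothesis Rcont : forall x, {within `[0, +oo[, continuous (fun s => Rs s x)}.
Context {d : measure_display} {Om : measurableType d} (P : probability Om R).
Variable Z : R -> Om -> H.
Hypothesis rZ : forall s, 0 <= s -> rvH (Z s).
Hypothesis Z0 : forall w, Z 0 w = 0.
Hypothesis iZ : forall (n : nat) (r : nat -> R), 0 <= r 0%N ->
  (forall k, (k < n)%N -> r k < r k.+1) ->
  indep_family P n (fun k w => Z (r k.+1) w - Z (r k) w).
Hypothesis sZ : forall s u B, 0 <= s -> s <= u -> borel_sets B ->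
  P ((fun w => Z u w - Z s w) @^-1` B) = P (Z (u - s) @^-1` B).
Hypothesis cZ : forall s eps : R, 0 <= s -> 0 < eps ->
  (fun u => P [set w | eps < `|Z u w - Z s w|])
    @ within [set u | 0 <= u] (nbhs s) --> 0%E.
Hypothesis cadZ : forall w s, 0 <= s ->
  (fun u => Z u w) @ s^'+ --> Z s w /\
  (0 < s -> exists l : H, (fun u => Z u w) @ s^'- --> l).

Definition psi (s : R) (x : H) : H := Rs (t - s) x.

Definition riemann_sum (m : nat) (r sg : nat -> R) (w : Om) : H :=
  \sum_(k < m) psi (sg k) (Z (r k.+1) w - Z (r k) w).

Definition fine_tagged (m : nat) (r sg : nat -> R) (dl : R) : Prop :=
  [/\ r 0%N = 0, r m = t, (forall k, (k < m)%N -> r k < r k.+1),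
      (forall k, (k < m)%N -> r k <= sg k <= r k.+1) &
      (forall k, (k < m)%N -> r k.+1 - r k <= dl)].

Lemma psi_dom s : 0 <= s <= t -> 0 <= t - s <= t.
Proof. by move=> /andP[s0 st]; rewrite subr_ge0 st lerBlDr lerDl. Qed.

Lemma psi_linear s : 0 <= s <= t -> linear_op (psi s).
Proof. by move=> /psi_dom; exact: Rlin. Qed.

Lemma psi_bound s x : 0 <= s <= t -> `|psi s x| <= M * `|x|.
Proof. by move=> /psi_dom; exact: RM. Qed.

Lemma psi_continuous s : 0 <= s <= t -> continuous (psi s).
Proof.
move=> hs; apply: (@lipschitz_continuous _ _ _ M) => x y.
by rewrite -(linear_opB _ _ (psi_linear hs)) psi_bound.
Qed.

Lemma fine_tagged_bounds m r sg dl k : fine_tagged m r sg dl -> (k <= m)%N ->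
  0 <= r k <= t.
Proof. by move=> [r0 rm rS _ _] km; apply: (partition_bounds r0 _ rS km); rewrite rm. Qed.

Lemma fine_tagged_tag m r sg dl k : fine_tagged m r sg dl -> (k < m)%N ->
  0 <= sg k <= t.
Proof.
move=> ft km; have [_ _ _ /(_ k km)/andP[h1 h2] _] := ft.
have /andP[h3 _] := fine_tagged_bounds ft (ltnW km).
have /andP[_ h4] := fine_tagged_bounds ft km.
by rewrite (le_trans h3 h1) (le_trans h2 h4).
Qed.

Lemma rvH_riemann_sum m r sg dl : fine_tagged m r sg dl -> rvH (riemann_sum m r sg).
Proof.
move=> ft; apply: (rvH_sum sepH (F := fun k w => psi (sg k) (Z (r k.+1) w - Z (r k) w))).
move=> k km; apply: (rvH_comp (psi_continuous (fine_tagged_tag ft km))).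
apply: rvHB => //; apply: rZ.
  by have /andP[] := fine_tagged_bounds ft km.
by have /andP[] := fine_tagged_bounds ft (ltnW km).
Qed.

(** * Dyadic step approximation and summation by parts *)

Section dyadic_step.
Variable L : nat.
Let g j : R := dyadic t L j.

Lemma dyadicS j : g j.+1 = g j + t / 2 ^+ L.
Proof. by rewrite /g /dyadic -natr1 mulrDl mulrDr mul1r. Qed.

Lemma dyadic_end : g (2 ^ L) = t.
Proof. by rewrite /g /dyadic natrX divff ?mulr1// gt_eqF// exprn_gt0. Qed.

Lemma dyadic_le j k : (j <= k)%N -> g j <= g k.
Proof. by move=> jk; rewrite /g /dyadic ler_pM2l// ler_pM2r ?invr_gt0 ?exprn_gt0// ler_nat. Qed.

Lemma dyadic_range j : (j <= 2 ^ L)%N -> 0 <= g j <= t.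
Proof. by move=> jL; rewrite dyadic_ge0//= -dyadic_end; exact: dyadic_le. Qed.

Definition jump j x := psi (g j.+1) x - psi (g j) x.

(** A sum of jumps, rather than a lookup of the dyadic cell of [s], so that exchanging this sum with
    the one over the partition is summation by parts. *)
Definition step_psi (s : R) (x : H) : H :=
  psi 0 x + \sum_(j < 2 ^ L) (g j.+1 < s)%R%:R *: jump j x.

Lemma step_psiE s : 0 <= s <= t -> exists J, [/\ (J <= 2 ^ L)%N,
  `|s - g J| <= t / 2 ^+ L & forall x, step_psi s x = psi (g J) x].
Proof.
move=> /andP[s0 st].
(* The indicators equal to 1 form an initial segment, so the jumps telescope to the value at its end
   [J]. *)
have key n : exists J, [/\ (J <= n)%N, g J <= s, (J = n \/ s <= g J.+1) &
    forall x, psi 0 x + \sum_(j < n) (g j.+1 < s)%R%:R *: jump j x = psi (g J) x].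
  elim: n => [|n [J [Jn gJ hJ E]]].
    have g0 : g 0%N = 0 by rewrite /g /dyadic mul0r mulr0.
    by exists 0%N; split; rewrite ?g0//; [left|move=> x; rewrite big_ord0 addr0].
  have [nJ|Js] : (g n.+1 < s /\ J = n) \/ s <= g n.+1 /\ s <= g J.+1.
  - have [gs|gs] := ltP (g n.+1) s; last first.
      by right; split=> //; case: hJ => [->|].
    left; split=> //; case: hJ => // sJ.
    by move: (lt_le_trans gs sJ); rewrite ltNge dyadic_le// ltnS.
  - exists n.+1; case: nJ => gs JnE; split=> //; [exact: ltW|by left|].
    move=> x; rewrite big_ord_recr /= addrA E JnE gs scale1r /jump addrC.
    by rewrite subrK.
  - exists J; case: Js => gs sJ; split=> //; [exact: ltnW|by right|].
    by move=> x; rewrite big_ord_recr /= addrA E ltNge gs scale0r addr0.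
have [J [JL gJ hJ E]] := key (2 ^ L)%N.
exists J; split=> //; rewrite ger0_norm ?subr_ge0//.
case: hJ => [JE|]; last by rewrite dyadicS lerBlDl.
by rewrite JE dyadic_end (le_trans (_ : _ <= 0)) ?subr_le0// divr_ge0 ?exprn_ge0// ltW.
Qed.

Lemma step_psi_controlled s : 0 <= s <= t ->
  controlled (osc Rs t L) (fun x => psi s x - step_psi s x).
Proof.
move=> hs; have [J [JL sJ E]] := step_psiE hs.
have hg := dyadic_range JL.
have -> : (fun x => psi s x - step_psi s x) = (fun x => psi s x - psi (g J) x).
  by apply/funext => x; rewrite E.
split.
- move=> c x y; rewrite (psi_linear hs) (psi_linear hg) opprD addrACA scalerBr.
  by [].
- by move=> x; apply: cvgB; exact: psi_continuous.
- move=> x; apply: (osc_ge t0 RM) => //; [exact: psi_dom|exact: psi_dom|].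
  by rewrite opprB addrC addrA subrK distrC.
Qed.

(** The integral of [step_psi] after summation by parts: each jump acts on the increment of [Z] from
    its own time up to [t]. *)
Definition dyadic_target (w : Om) : H :=
  psi 0 (Z t w) + \sum_(j < 2 ^ L) jump j (Z t w - Z (g j.+1) w).

Lemma jump_linear j : (j < 2 ^ L)%N -> linear_op (jump j).
Proof.
move=> jL c x y; rewrite /jump (psi_linear (dyadic_range jL)).
rewrite (psi_linear (dyadic_range (ltnW jL))) opprD addrACA scalerBr.
by [].
Qed.

Lemma jump_bound j x : (j < 2 ^ L)%N -> `|jump j x| <= 2 * M * `|x|.
Proof.
move=> jL; rewrite (le_trans (ler_normB _ _))// -mulrA mulr_natl mulr2n.
by rewrite lerD// psi_bound//; apply: dyadic_range => //; exact: ltnW.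
Qed.

(* The increments tagged to the right of [a] telescope, up to moving [a] to a
   partition point. *)
Lemma tagged_tail m r sg dl a : fine_tagged m r sg dl -> 0 <= a <= t ->
  exists rho, [/\ 0 <= rho, `|rho - a| <= dl & forall w,
    \sum_(k < m) (a < sg k)%R%:R *: (Z (r k.+1) w - Z (r k) w) = Z t w - Z rho w].
Proof.
move=> ft /andP[a0 at']; have [r0 rm rS sgP hdl] := ft.
have dl0 : 0 <= dl.
  case: m {ft} rm rS sgP hdl => [|m] rm rS _ hdl; first by move: t0; rewrite -rm r0 ltxx.
  by rewrite (le_trans _ (hdl 0%N _))// subr_ge0 ltW// rS.
(* As long as [r n <= a], no tag has passed [a] and [rho] follows [r n]; from the first tag beyond
   [a] on, [rho] is frozen. *)
have key n : (n <= m)%N -> exists rho, [/\ 0 <= rho, (r n <= a -> rho = r n),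
    (a <= r n -> `|rho - a| <= dl) & forall w,
    \sum_(k < n) (a < sg k)%R%:R *: (Z (r k.+1) w - Z (r k) w) = Z (r n) w - Z rho w].
  elim: n => [_|n IH nm].
    exists 0; split=> //.
      move=> a0'; have -> : a = 0 by apply/le_anti; rewrite a0 -r0 a0'.
      by rewrite subrr normr0.
    by move=> w; rewrite big_ord0 r0 subrr.
  have [rho [rho0 h1 h2 E]] := IH (ltnW nm).
  have /andP[sg1 sg2] := sgP n nm.
  have [asg|asg] := ltP a (sg n).
    exists rho; split=> //.
    - by move=> h; move: (lt_le_trans asg sg2); rewrite ltNge h.
    - move=> _; have [|rna] := leP a (r n); first exact: h2.
      rewrite h1; last exact: ltW.
      rewrite ler0_norm ?subr_le0 1?ltW// opprB.
      have := hdl n nm; have := lt_le_trans asg sg2; lra.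
    - by move=> w; rewrite big_ord_recr /= E asg scale1r addrC addrA subrK.
  have rna : r n <= a by exact: le_trans asg.
  exists (r n.+1); split=> //.
  - by have /andP[] := fine_tagged_bounds ft nm.
  - move=> arn; rewrite ger0_norm ?subr_ge0//.
    by have := hdl n nm; lra.
  - move=> w; rewrite big_ord_recr /= E ltNge asg scale0r addr0 subrr.
    by rewrite h1// subrr.
have [rho [rho0 _ h2 E]] := key m (leqnn m).
by exists rho; split=> // [|w]; [apply: h2; rewrite rm|rewrite E rm].
Qed.

Lemma rvH_dyadic_target : rvH dyadic_target.
Proof.
apply: rvHD => //.
  by apply: (rvH_comp (psi_continuous _)); [rewrite lexx ltW|apply: rZ; exact: ltW].
apply: (rvH_sum sepH (F := fun j w => jump j (Z t w - Z (g j.+1) w))) => j jL.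
have cj : continuous (jump j).
  apply: (@lipschitz_continuous _ _ _ (2 * M)) => x y.
  by rewrite -(linear_opB _ _ (jump_linear jL)) jump_bound.
apply: (rvH_comp cj); apply: rvHB => //; apply: rZ; first exact: ltW.
by have /andP[] := dyadic_range jL.
Qed.

Lemma linear_op_sum (B : H -> H) n (c : 'I_n -> R) (x : 'I_n -> H) : linear_op B ->
  B (\sum_k c k *: x k) = \sum_k c k *: B (x k).
Proof.
move=> lB; elim/big_rec2: _ => [|k y1 y2 _ <-]; first exact: linear_op0.
exact: lB.
Qed.

Lemma linear_opD (B : H -> H) x y : linear_op B -> B (x + y) = B x + B y.
Proof. by move=> lB; have := lB 1 x y; rewrite !scale1r. Qed.

(** The first sum has controlled operators; the second has a number of terms fixed by [L]. The times
    [rho j] do not depend on [w], so stochastic continuity applies to them. *)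
Lemma riemann_sum_decomposition m r sg dl : fine_tagged m r sg dl ->
  exists rho : nat -> R, (forall j, (j < 2 ^ L)%N ->
    0 <= rho j /\ `|rho j - g j.+1| <= dl) /\
  forall w, riemann_sum m r sg w - dyadic_target w =
    \sum_(k < m) (fun x => psi (sg k) x - step_psi (sg k) x)
                   (Z (r k.+1) w - Z (r k) w) +
    \sum_(j < 2 ^ L) jump j (Z (g j.+1) w - Z (rho j) w).
Proof.
move=> ft; have [r0 rm rS _ _] := ft.
have /choice[rho hrho] : forall j, exists rho, (j < 2 ^ L)%N -> [/\ 0 <= rho,
    `|rho - g j.+1| <= dl & forall w,
    \sum_(k < m) (g j.+1 < sg k)%R%:R *: (Z (r k.+1) w - Z (r k) w) = Z t w - Z rho w].
  move=> j; have [jL|jL] := ltnP j (2 ^ L); last by exists 0.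
  have [rho hrho] := tagged_tail ft (dyadic_range jL).
  by exists rho.
exists rho; split=> [j jL|w]; first by have [] := hrho j jL.
have h0 : 0 <= (0 : R) <= t by rewrite lexx ltW.
have E : \sum_(k < m) step_psi (sg k) (Z (r k.+1) w - Z (r k) w) =
    psi 0 (Z t w) + \sum_(j < 2 ^ L) jump j (Z t w - Z (rho j) w).
  rewrite big_split /=; congr (_ + _).
    transitivity (psi 0 (\sum_(k < m) (Z (r k.+1) w - Z (r k) w))).
      elim/big_rec2: _ => [|k y1 y2 _ ->]; first by rewrite (linear_op0 (psi_linear h0)).
      by rewrite [RHS](linear_opD _ _ (psi_linear h0)).
    congr (psi 0 _).
    rewrite -(big_mkord xpredT (fun k => Z (r k.+1) w - Z (r k) w)).
    by rewrite (telescope_sumr (fun k => Z (r k) w))// rm r0 Z0 subr0.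
  rewrite exchange_big /=; apply: eq_bigr => j _.
  have [_ _ <-] := hrho j (ltn_ord j).
  by rewrite (linear_op_sum _ _ (jump_linear (ltn_ord j))).
have E2 : \sum_(j < 2 ^ L) jump j (Z t w - Z (rho j) w) =
    \sum_(j < 2 ^ L) jump j (Z t w - Z (g j.+1) w) +
    \sum_(j < 2 ^ L) jump j (Z (g j.+1) w - Z (rho j) w).
  rewrite -big_split /=; apply: eq_bigr => j _.
  by rewrite -(linear_opD _ _ (jump_linear (ltn_ord j))) addrA subrK.
by rewrite sumrB E E2 /dyadic_target /riemann_sum !opprD !addrA addrNK.
Qed.

End dyadic_step.

Lemma stoch_cont_uniform (a : nat -> R) N eta kappa : (forall j, 0 <= a j) ->
  0 < eta -> 0 < kappa -> exists dl, 0 < dl /\ forall j rho, (j < N)%N ->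
    0 <= rho -> `|rho - a j| <= dl -> far P eta (Z (a j)) (Z rho) <= kappa.
Proof.
move=> a0 eta0 kappa0; elim: N => [|N [dl [dl0 IH]]]; first by exists 1.
have /fine_cvgP[_ /cvgrPdist_lt/(_ _ kappa0)] := cZ (a0 N) eta0.
move=> /nbhs_normP[e /= e0 he].
exists (Num.min dl (e / 2)); split; first by rewrite lt_min dl0 divr_gt0.
move=> j rho; rewrite ltnS leq_eqVlt => /predU1P[->|jN] rho0; last first.
  by rewrite le_min => /andP[h _]; exact: IH.
rewrite le_min => /andP[_ h]; rewrite farC.
have hr : `|a N - rho| < e.
  by rewrite distrC (le_lt_trans h)// ltr_pdivrMr// ltr_pMr// ltr1n.
by have := he rho hr rho0; rewrite /= sub0r normrN => /ltr_normlW/ltW.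
Qed.

(** The level [L] is fixed from [e] alone, since the controlled sum is small for every partition;
    only then is [dl] chosen, depending on [L], to make the [2 ^ L] displacements small. *)
Lemma riemann_approx e : 0 < e -> exists L dl, 0 < dl /\
  forall m r sg, fine_tagged m r sg dl ->
    far P e (riemann_sum m r sg) (dyadic_target L) <= e.
Proof.
move=> e0.
pose lam := e / 2; have lam0 : 0 < lam by rewrite divr_gt0.
(* With [del = lam * th] the Chebyshev term is [48 * th ^ 2 + 16 * th], at most [64 * th <= e / 4]
   since [th <= 1]. Together with [kappa <= e / 4] this gives [lam = e / 2]. *)
pose th := Num.min 1 (e / 256).
have th0 : 0 < th by rewrite lt_min ltr01 divr_gt0.
have th1 : th <= 1 by rewrite ge_min lexx.
have the : th <= e / 256 by rewrite ge_min lexx orbT.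
pose del := lam * th; have del0 : 0 < del by rewrite mulr_gt0.
pose kappa := Num.min (1 / 2) (e / 4).
have kappa0 : 0 < kappa by rewrite lt_min !divr_gt0.
have kappa2 : kappa <= 1 / 2 by rewrite ge_min lexx.
have kappae : kappa <= e / 4 by rewrite ge_min lexx orbT.
have del2 : 0 < del / 2 by rewrite divr_gt0.
have [L hL] := bad_event t0 Rlin RM Rcont P rZ cadZ del2 kappa0.
have [Bad [mBad PBad hBad]] := hL L (leqnn L).
pose N := (2 ^ L)%N.
have N0 : 0 < N%:R :> R by rewrite ltr0n expn_gt0.
(* [N] jumps, each with operator bound [M'], turn displacements [eta] into a total of [lam]; their
   exceptional events, of probability [lam / N] each, also add up to [lam]. The [+ 1] makes [M']
   positive. *)
pose M' := 2 * `|M| + 1; have M'0 : 0 < M' by rewrite ltr_wpDl.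
pose eta := lam / (N%:R * M').
have eta0 : 0 < eta by rewrite divr_gt0// mulr_gt0.
have kN : 0 < lam / N%:R by rewrite divr_gt0.
have [dl [dl0 hdl]] := stoch_cont_uniform N
  (a := fun j => dyadic t L j.+1) (fun j => dyadic_ge0 t0 L j.+1) eta0 kN.
exists L, dl; split=> // m r sg ft.
have [r0 rm rS _ _] := ft.
have [rho [hrho E]] := riemann_sum_decomposition L ft.
pose B k x := psi (sg k) x - step_psi L (sg k) x.
pose A1 := [set w | lam < `|\sum_(k < m) B k (Z (r k.+1) w - Z (r k) w)|].
have cB k : (k < m)%N -> controlled (osc Rs t L) (B k).
  by move=> km; apply: step_psi_controlled; exact: fine_tagged_tag ft km.
have PA1 : fine (P A1) <= lam.
  apply: le_trans (controlled_sum_small ipH sepH t0 rZ Z0 iZ sZ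
    (osc_continuous t0 Rlin RM (L := L)) (oscB t0 Rlin RM L) del0 mBad
    (le_trans PBad kappa2) hBad lam0 r0 rm rS cB) _.
  have -> : (48 * del ^+ 2 + 16 * lam * del) / lam ^+ 2 = 48 * th ^+ 2 + 16 * th.
    by rewrite /del; field; rewrite gt_eqF.
  have : th ^+ 2 <= th by rewrite expr2 ler_piMr// ltW.
  rewrite /lam; move: PBad kappae the; lra.
have mA1 : measurable A1.
  apply: measurable_set_ltr => //; apply: rvH_norm.
  apply: (rvH_sum sepH (F := fun k w => B k (Z (r k.+1) w - Z (r k) w))) => k km.
  have [_ cBk _] := cB k km; apply: (rvH_comp cBk); apply: rvHB => //; apply: rZ.
    by have /andP[] := fine_tagged_bounds ft km.
  by have /andP[] := fine_tagged_bounds ft (ltnW km).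
pose A2 j := [set w | eta < `|Z (dyadic t L j.+1) w - Z (rho j) w|].
have mA2 j : (j < N)%N -> measurable (A2 j).
  move=> jN; apply: measurable_far => //; apply: rZ; first exact: dyadic_ge0.
  by have [] := hrho j jN.
have [mU PU] := fine_prob_bigU P mA2.
have PA2 : fine (P (\big[setU/set0]_(j < N) A2 j)) <= lam.
  rewrite (le_trans PU)//.
  have -> : lam = \sum_(j < N) lam / N%:R.
    by rewrite sumr_const card_ord -[RHS]mulr_natr divfK// gt_eqF.
  apply: ler_sum => j _; have [h1 h2] := hrho j (ltn_ord j).
  exact: hdl.
rewrite [leRHS](splitr e) (le_trans _ (lerD PA1 PA2))//.
apply: le_trans (fine_probU P mA1 mU).
apply: fine_prob_le; [|exact: measurableU|].
  by apply: measurable_far => //; [exact: rvH_riemann_sum ft|exact: rvH_dyadic_target].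
move=> w /=; rewrite E => ew.
have [h1|h1] := leP `|\sum_(k < m) B k (Z (r k.+1) w - Z (r k) w)| lam; last by left.
right; apply: contrapT => nU.
have h2 j : (j < N)%N -> `|Z (dyadic t L j.+1) w - Z (rho j) w| <= eta.
  move=> jN; rewrite leNgt; apply/negP => hj; apply: nU.
  by rewrite -(bigcup_mkord N A2); exists j.
have h3 : `|\sum_(j < N) jump L j (Z (dyadic t L j.+1) w - Z (rho j) w)| <= lam.
  rewrite (le_trans (ler_norm_sum _ _ _))//.
  have -> : lam = \sum_(j < N) M' * eta.
    rewrite sumr_const card_ord -[RHS]mulr_natr /eta.
    by field; rewrite !gt_eqF.
  apply: ler_sum => j _; rewrite (le_trans (jump_bound _ (ltn_ord j)))//.
  rewrite (@le_trans _ _ (M' * `|Z (dyadic t L j.+1) w - Z (rho j) w|))//.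
    rewrite ler_wpM2r// /M' (@le_trans _ _ (2 * `|M|))//; last by rewrite lerDl.
    by rewrite ler_pM2l// ler_norm.
  by rewrite ler_pM2l//; exact: h2.
move: ew; rewrite ltNge => /negP; apply.
by rewrite (le_trans (ler_normD _ _))// [leRHS](splitr e) lerD.
Qed.

Definition dyadic_sum L := riemann_sum (2 ^ L) (dyadic t L) (dyadic t L).

Lemma fine_tagged_dyadic L dl : t / 2 ^+ L <= dl ->
  fine_tagged (2 ^ L) (dyadic t L) (dyadic t L) dl.
Proof.
move=> hdl; have tL : 0 < t / 2 ^+ L by rewrite divr_gt0// exprn_gt0.
split.
- by rewrite /dyadic mul0r mulr0.
- exact: dyadic_end.
- by move=> k _; rewrite dyadicS ltrDl.
- by move=> k _; rewrite dyadicS lexx lerDl ltW.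
- by move=> k _; rewrite dyadicS addrAC subrr add0r.
Qed.

Lemma rvH_dyadic_sum L : rvH (dyadic_sum L).
Proof. exact: rvH_riemann_sum (fine_tagged_dyadic (lexx _)). Qed.

(** The dyadic sums only construct [Y] and its measurability. Every sufficiently fine sum is close
    to the same [dyadic_target L], which is why the limit does not depend on partitions or tags. *)
Theorem riemann_limit (G : set (set Om)) : <<s G >> `<=` measurable ->
  (forall L k, (k <= 2 ^ L)%N -> rv_wrt <<s G >> (Z (dyadic t L k))) ->
  exists Y, rv_wrt <<s G >> Y /\ forall e : R, 0 < e -> exists dl, 0 < dl /\
    forall m r sg, fine_tagged m r sg dl -> far P e (riemann_sum m r sg) Y <= e.
Proof.
move=> Gm rG.
have approx e : 0 < e -> exists L dl n0, [/\ 0 < dl,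
    (forall m r sg, fine_tagged m r sg dl ->
      far P e (riemann_sum m r sg) (dyadic_target L) <= e) &
    forall n, (n0 <= n)%N -> far P e (dyadic_sum n) (dyadic_target L) <= e].
  move=> e0; have [L [dl [dl0 h]]] := riemann_approx e0.
  have [n0 hn0] := small_mesh t0 dl0.
  exists L, dl, n0; split=> // n /hn0/ltW hn.
  exact/h/fine_tagged_dyadic.
have rGD L : rv_wrt <<s G >> (dyadic_sum L).
  apply: (@rvH_sum _ _ _ (g_sigma_algebraType G) sepH (2 ^ L)
    (fun k w => psi (dyadic t L k) (Z (dyadic t L k.+1) w - Z (dyadic t L k) w))).
  move=> k kL; apply: (@rvH_comp _ _ _ (g_sigma_algebraType G)).
    by apply: psi_continuous; apply: dyadic_range; exact: ltnW.
  by apply: (@rvHB _ _ _ (g_sigma_algebraType G) sepH); apply: rG => //; exact: ltnW.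
have [|Y [rGY DY]] := cauchy_in_prob_limit sepH Gm rGD (P := P).
  move=> e e0; have e2 : 0 < e / 2 by rewrite divr_gt0.
  have [L [dl [n0 [dl0 _ h]]]] := approx _ e2.
  exists n0 => n m hn hm; rewrite {1}(splitr e) [leRHS](splitr e).
  rewrite (le_trans (far_triangle sepH P _ _ (rvH_dyadic_sum n)
    (rvH_dyadic_target L) (rvH_dyadic_sum m)))// lerD ?h// farC; exact: h.
exists Y; split=> // e e0; have e3 : 0 < e / 3 by rewrite divr_gt0.
have [L [dl [n0 [dl0 h1 h2]]]] := approx _ e3.
have [n1 h3] := DY _ e3.
exists dl; split=> // m r sg ft.
have rY : rvH Y by move=> B mB; apply: Gm; exact: rGY.
have rT := rvH_dyadic_target L.
have rS := rvH_riemann_sum ft.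
have eE : e = e / 3 + (e / 3 + e / 3) by field.
rewrite {1}eE [leRHS]eE (le_trans (far_triangle sepH P _ _ rS rT rY))// lerD ?h1//.
rewrite (le_trans (far_triangle sepH P _ _ rT (rvH_dyadic_sum (maxn n0 n1)) rY))//.
by apply: lerD; [rewrite farC h2// leq_maxl|rewrite h3// leq_maxr].
Qed.

End riemann_sums.

(** * Laws of limits *)

Section laws.
Context {R : realType} {H : completeNormedModType R}.
Hypothesis sepH : exists u : nat -> H, dense (range u).
Context {d : measure_display} {Om : measurableType d} (P : probability Om R).
Implicit Types X Y : nat -> Om -> H.
Local Notation borelH := (g_sigma_algebraType (@open H)).

(** An erosion of [U]: moving a point by less than [r] keeps it in [U], which absorbs the error of
    convergence in probability. *)
Definition inner (r : R) (U : set H) : set H := [set x | forall y, `|x - y| < r -> U y].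

Lemma inner_borel r U : borel_sets (inner r U).
Proof.
have -> : inner r U = ~` (\bigcup_(y in ~` U) [set x | `|x - y| < r]).
  apply/seteqP; split=> x /=; first by move=> h [y nU xy]; apply: nU; exact: h.
  by move=> h y xy; apply: contrapT => nU; apply: h; exists y.
apply: (@measurableC _ borelH); apply: open_borel; apply: bigcup_open => y _.
have [r0|r0] := ltP 0 r.
  have -> : [set x | `|x - y| < r] = ball y r.
    by rewrite -ball_normE; apply/seteqP; split=> x /=; rewrite distrC.
  exact: ball_open.
have -> : [set x | `|x - y| < r] = set0; last exact: open0.
by apply/seteqP; split=> // x /= /lt_le_trans/(_ r0); rewrite normr_lt0.
Qed.

Lemma open_innerE U : open U -> U = \bigcup_k inner k.+1%:R^-1 U.
Proof.
move=> oU; apply/seteqP; split=> x.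
  move=> Ux; have := oU; rewrite openE => /(_ _ Ux)/nbhs_ballP[e /= e0 eU].
  have [k] : exists k, 0 + k.+1%:R^-1 < e by apply: ltr_add_invr.
  rewrite add0r => ke; exists k => // y xy; apply: eU.
  by rewrite -ball_normE /=; exact: lt_trans ke.
by move=> [k _ /(_ x)]; rewrite subrr normr0 invr_gt0 ltr0n; exact.
Qed.

Definition prob_cvg X (Y : Om -> H) := forall e : R, 0 < e ->
  exists n0, forall n, (n0 <= n)%N -> far P e (X n) Y <= e.

(** From [inner r U] for [Y] to [inner (r / 2) U] for [X n], across to [X' n] by equality of laws,
    then to [U] for [Y']; finally [r] tends to 0, as an open set is the union of its erosions. *)
Lemma law_limit_le X X' (Y Y' : Om -> H) (U : set H) :
  (forall n, rvH (X n)) -> (forall n, rvH (X' n)) -> rvH Y -> rvH Y' ->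
  prob_cvg X Y -> prob_cvg X' Y' ->
  (forall n B, borel_sets B -> P (X n @^-1` B) = P (X' n @^-1` B)) ->
  open U -> (P (Y @^-1` U) <= P (Y' @^-1` U))%E.
Proof.
move=> rX rX' rY rY' XY XY' XX' oU.
have inner_le r : 0 < r -> fine (P (Y @^-1` inner r U)) <= fine (P (Y' @^-1` U)).
  move=> r0; apply/ler_addgt0Pr => eta eta0.
  pose e := Num.min (r / 4) (eta / 2).
  have e0 : 0 < e by rewrite lt_min !divr_gt0.
  have er : e <= r / 4 by rewrite ge_min lexx.
  have ee : e <= eta / 2 by rewrite ge_min lexx orbT.
  have [n0 h] := XY e e0; have [n1 h'] := XY' e e0.
  pose n := maxn n0 n1.
  have mV : borel_sets (inner (r / 2) U) by exact: inner_borel.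
  have mF := measurable_far sepH e (rX n) rY.
  have mF' := measurable_far sepH e (rX' n) rY'.
  have s1 : fine (P (Y @^-1` inner r U)) <= fine (P (X n @^-1` inner (r / 2) U)) + e.
    rewrite (@le_trans _ _ (fine (P (X n @^-1` inner (r / 2) U)) + far P e (X n) Y))//.
      apply: le_trans (fine_probU P (rX n _ mV) mF).
      apply: fine_prob_le; [exact: rY _ (inner_borel _ _)|by apply: measurableU => //; exact: rX|].
      move=> w /= Yw; have [XYw|XYw] := leP `|X n w - Y w| e; last by right.
      left=> y Xy; apply: Yw; rewrite (le_lt_trans (ler_distD (X n w) _ _))//.
      rewrite distrC in XYw; lra.
    by rewrite lerD2l h// leq_maxl.
  have s2 : fine (P (X' n @^-1` inner (r / 2) U)) <= fine (P (Y' @^-1` U)) + e.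
    rewrite (@le_trans _ _ (fine (P (Y' @^-1` U)) + far P e (X' n) Y'))//.
      have mU : measurable (Y' @^-1` U) by apply: rY'; exact: open_borel.
      apply: le_trans (fine_probU P mU mF').
      apply: fine_prob_le; [exact: rX'|exact: measurableU|].
      move=> w /= Xw; have [XYw|XYw] := leP `|X' n w - Y' w| e; last by right.
      left; apply: Xw; lra.
    by rewrite lerD2l h'// leq_maxr.
  rewrite XX'// in s1; move: s1 s2 ee; lra.
have mU : measurable (Y' @^-1` U) by apply: rY'; exact: open_borel.
have mi k : measurable (Y @^-1` inner k.+1%:R^-1 U) by exact: rY _ (inner_borel _ _).
have cv : P \o (fun k => Y @^-1` inner k.+1%:R^-1 U) @ \oo --> P (Y @^-1` U).
  rewrite {2}(open_innerE oU) preimage_bigcup; apply: nondecreasing_cvg_mu => //.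
    exact: bigcup_measurable.
  move=> k k' kk; apply/subsetPset => w /= h y hy; apply: h; apply: lt_le_trans hy _.
  by rewrite lef_pV2 ?posrE ?ltr0n// ler_nat.
rewrite -(cvg_lim _ cv)//; apply: lime_le; first exact: cvgP cv.
apply: nearW => k /=; rewrite -(fine_probE P mU) -(fine_probE P (mi k)) lee_fin.
by apply: inner_le; rewrite invr_gt0.
Qed.

Lemma law_limit X X' (Y Y' : Om -> H) :
  (forall n, rvH (X n)) -> (forall n, rvH (X' n)) -> rvH Y -> rvH Y' ->
  prob_cvg X Y -> prob_cvg X' Y' ->
  (forall n B, borel_sets B -> P (X n @^-1` B) = P (X' n @^-1` B)) ->
  forall B, borel_sets B -> P (Y @^-1` B) = P (Y' @^-1` B).
Proof.
move=> rX rX' rY rY' XY XY' XX' B mB.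
have mY : measurable_fun setT (Y : Om -> borelH) by apply/rvH_measurable_fun.
have mY' : measurable_fun setT (Y' : Om -> borelH) by apply/rvH_measurable_fun.
pose Yf : {mfun Om >-> borelH} := HB.pack (Y : Om -> borelH) (isMeasurableFun.Build _ _ _ _ _ mY).
pose Yf' : {mfun Om >-> borelH} := HB.pack (Y' : Om -> borelH) (isMeasurableFun.Build _ _ _ _ _ mY').
apply: (@measure_unique _ R borelH (@open H) (fun=> setT) erefl _ _ _
  (pushforward P Yf) (pushforward P Yf') _ _ B mB).
- by move=> U V; exact: openI.
- by move=> _; exact: openT.
- by rewrite bigcup_const.
- move=> U oU; apply/eqP; rewrite eq_le; apply/andP; split.
    exact: (law_limit_le rX rX').
  by apply: (law_limit_le rX' rX) => // n C mC; rewrite XX'.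
- by move=> _; rewrite /= /pushforward preimage_setT probability_setT ltry.
Qed.

Lemma indep_family_perm X K (p p' : nat -> nat) :
  (forall i, (i < K)%N -> (p i < K)%N /\ p' (p i) = i) ->
  (forall i, (i < K)%N -> (p' i < K)%N /\ p (p' i) = i) ->
  indep_family P K X -> indep_family P K (fun i => X (p i)).
Proof.
move=> hp hp' iX B mB.
have -> : \bigcap_(i < K) (X (p i) @^-1` B i) = \bigcap_(i < K) (X i @^-1` B (p' i)).
  apply/seteqP; split=> w h i /= iK.
    have [iK' e] := hp' i iK; have /= := h _ iK'; by rewrite e.
  have [iK' e] := hp i iK; have /= := h _ iK'; by rewrite e.
rewrite (iX (fun i => B (p' i)) (fun i => mB _)).
rewrite (reindex_onto (fun i : 'I_K => Ordinal (hp i (ltn_ord i)).1)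
  (fun i : 'I_K => Ordinal (hp' i (ltn_ord i)).1)) /=; last first.
  by move=> i _; apply: val_inj; rewrite /=; have [] := hp' i (ltn_ord i).
apply: eq_big => i.
  by apply/eqP; apply: val_inj; rewrite /=; have [] := hp i (ltn_ord i).
by move=> _; have [_ ->] := hp i (ltn_ord i).
Qed.

Lemma farD a b (X1 X2 Y1 Y2 : Om -> H) : rvH X1 -> rvH X2 -> rvH Y1 -> rvH Y2 ->
  far P (a + b) (fun w => X1 w + X2 w) (fun w => Y1 w + Y2 w) <=
  far P a X1 Y1 + far P b X2 Y2.
Proof.
move=> r1 r2 r3 r4.
apply: le_trans (fine_probU P (measurable_far sepH a r1 r3) (measurable_far sepH b r2 r4)).
apply: fine_prob_le.
- by apply: measurable_far => //; exact: rvHD.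
- by apply: measurableU; exact: measurable_far.
move=> w /= h; have [h1|h1] := leP `|X1 w - Y1 w| a; last by left.
right; rewrite ltNge; apply/negP => h2; move: h; rewrite ltNge => /negP; apply.
by rewrite opprD addrACA (le_trans (ler_normD _ _))// lerD.
Qed.

Lemma prob_cvg_sum n (X : nat -> nat -> Om -> H) (Y : nat -> Om -> H) :
  (forall j L, rvH (X j L)) -> (forall j, rvH (Y j)) ->
  (forall j, prob_cvg (X j) (Y j)) ->
  prob_cvg (fun L w => \sum_(j < n) X j L w) (fun w => \sum_(j < n) Y j w).
Proof.
move=> rX rY XY; elim: n => [|n IH] e e0.
  exists 0%N => L _; rewrite /far (_ : [set w | _] = set0) ?measure0 ?ltW//.
  apply/seteqP; split=> // w /=; rewrite !big_ord0 subrr normr0 ltNge ltW//.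
have e2 : 0 < e / 2 by rewrite divr_gt0.
have [n0 h0] := IH _ e2; have [n1 h1] := XY n _ e2.
exists (maxn n0 n1) => L; rewrite geq_max => /andP[L0 L1].
under eq_fun do rewrite big_ord_recr /=.
under [X in far _ _ _ X]eq_fun do rewrite big_ord_recr /=.
rewrite {1}(splitr e) [leRHS](splitr e) (le_trans (farD _ _ _ _ _ _))//.
- by apply: (rvH_sum sepH (F := fun j => X j L)).
- by apply: (rvH_sum sepH (F := Y)).
- by rewrite lerD ?h0 ?h1.
Qed.

End laws.

(** * Infinite divisibility *)

Section levy.
Context {R : realType} {H : completeNormedModType R}.
Hypothesis sepH : exists u : nat -> H, dense (range u).
Context {d : measure_display} {Om : measurableType d} (P : probability Om R).

(** The constant filtration reduces adaptedness to measurability; a process rescaled in time need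
    not be adapted to the original filtration. *)
Definition levy (Z : R -> Om -> H) := levy_process P (fun=> measurable) Z.

Lemma levy_process_levy F Z : filtration F -> levy_process P F Z -> levy Z.
Proof.
move=> [Fm _] [aZ h]; split=> // s s0 B mB.
by have [_ sub] := Fm s s0; apply: sub; exact: aZ.
Qed.

(** * Shifted and rescaled Levy processes *)

Section rescaling.
Variables (Z : R -> Om -> H) (a c : R).
Hypotheses (LZ : levy Z) (a0 : 0 <= a) (c0 : 0 < c).

Definition rescaled (s : R) (w : Om) : H := Z (a + s * c) w - Z a w.

Let aff_cont : continuous (fun s : R => a + s * c).
Proof.
move=> s; apply: cvgD; first exact: cvg_cst.
by apply: cvgM; [exact: cvg_id|exact: cvg_cst].
Qed.

Let aff_within (D D' : set R) (s : R) : (forall u, D u -> D' (a + u * c)) ->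
  (fun u => a + u * c) @ within D (nbhs s) --> within D' (nbhs (a + s * c)).
Proof.
move=> DD A nA.
have h : nbhs s [set u | D' (a + u * c) -> A (a + u * c)] by exact: aff_cont nA.
change (nbhs s [set u | D u -> A (a + u * c)]).
by apply: filterS h => u h Du; exact/h/DD.
Qed.

Let aff_ge0 s : 0 <= s -> 0 <= a + s * c.
Proof. by move=> s0; rewrite addr_ge0// mulr_ge0// ltW. Qed.

Lemma rescaledB s u w : rescaled u w - rescaled s w = Z (a + u * c) w - Z (a + s * c) w.
Proof. by rewrite /rescaled opprB addrA subrK. Qed.

Lemma levy_rescaled : levy rescaled.
Proof.
have [rZ [Z0 iZ sZ cZ cadZ]] := LZ.
split=> [s s0|].
  by apply: (rvHB sepH); apply: rZ => //; exact: aff_ge0.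
split.
- by move=> w; rewrite /rescaled mul0r addr0 subrr.
- move=> n r r0 rS.
  have rS' k : (k < n)%N -> a + r k * c < a + r k.+1 * c.
    by move=> kn; rewrite ltrD2l ltr_pM2r// rS.
  have -> : (fun k w => rescaled (r k.+1) w - rescaled (r k) w) =
      (fun k w => Z (a + r k.+1 * c) w - Z (a + r k * c) w).
    by apply/funext => k; apply/funext => w; rewrite rescaledB.
  exact: (iZ n (fun k => a + r k * c) (aff_ge0 r0) rS').
- move=> s u B s0 su mB.
  have -> : (fun w => rescaled u w - rescaled s w) =
      (fun w => Z (a + u * c) w - Z (a + s * c) w).
    by apply/funext => w; rewrite rescaledB.
  have E x y : a + y * c - (a + x * c) = (y - x) * c by ring.
  rewrite sZ ?E//; [|exact: aff_ge0|by rewrite lerD2l ler_pM2r].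
  have := sZ a (a + (u - s) * c) B a0; rewrite lerDl mulr_ge0 ?subr_ge0// ?ltW//.
  by move=> /(_ isT mB) ->; congr (P (Z _ @^-1` B)); ring.
- move=> s eps s0 eps0.
  have -> : (fun u => P [set w | eps < `|rescaled u w - rescaled s w|]) =
      (fun v => P [set w | eps < `|Z v w - Z (a + s * c) w|]) \o (fun u => a + u * c).
    apply/funext => u /=; congr (P _); apply/seteqP; split=> w /=; by rewrite rescaledB.
  apply: cvg_comp (cZ (a + s * c) eps (aff_ge0 s0) eps0).
  by apply: aff_within => u; exact: aff_ge0.
- move=> w s s0; have [cr cl] := cadZ w (a + s * c) (aff_ge0 s0); split.
    apply: cvgB; last exact: cvg_cst.
    apply: (@cvg_comp _ _ _ (fun u => a + u * c) (fun v => Z v w)) cr.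
    by apply: aff_within => u /= su; rewrite ltrD2l ltr_pM2r.
  move=> s_gt0; have [|l hl] := cl; first by rewrite ltr_wpDl// mulr_gt0.
  exists (l - Z a w); apply: cvgB; last exact: cvg_cst.
  apply: (@cvg_comp _ _ _ (fun u => a + u * c) (fun v => Z v w)) hl.
  by apply: aff_within => u /= su; rewrite ltrD2l ltr_pM2r.
Qed.

End rescaling.
End levy.

Section infinite_divisibility.
Context {R : realType} {H : completeNormedModType R} (ip : H -> H -> R).
Hypothesis ipH : is_inner_product ip.
Hypothesis sepH : exists u : nat -> H, dense (range u).
Variables (Rs : R -> H -> H) (t M : R).
Hypothesis t0 : 0 < t.
Hypothesis Rlin : forall s, 0 <= s <= t -> linear_op (Rs s).
Hypothesis RM : forall s x, 0 <= s <= t -> `|Rs s x| <= M * `|x|.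
Hypothesis Rcont : forall x, {within `[0, +oo[, continuous (fun s => Rs s x)}.
Context {d : measure_display} {Om : measurableType d} (P : probability Om R).

Definition riemann_limit_of (Z : R -> Om -> H) (Y : Om -> H) :=
  forall e : R, 0 < e -> exists dl, 0 < dl /\ forall m r sg,
    fine_tagged t m r sg dl -> far P e (riemann_sum Rs t Z m r sg) Y <= e.

Lemma levy_riemann_limit Z (G : set (set Om)) : levy P Z -> <<s G >> `<=` measurable ->
  (forall L k, (k <= 2 ^ L)%N -> rv_wrt <<s G >> (Z (dyadic t L k))) ->
  exists Y, rv_wrt <<s G >> Y /\ riemann_limit_of Z Y.
Proof.
move=> [rZ [Z0 iZ sZ cZ cadZ]] Gm rG.
exact: (riemann_limit ipH sepH t0 Rlin RM Rcont rZ Z0 iZ sZ cZ cadZ Gm rG).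
Qed.

Lemma riemann_limit_dyadic Z Y : riemann_limit_of Z Y ->
  prob_cvg P (dyadic_sum Rs t Z) Y.
Proof.
move=> h e e0; have [dl [dl0 hdl]] := h e e0.
have [n0 hn0] := small_mesh t0 dl0.
by exists n0 => L /hn0/ltW hL; apply: hdl; exact: fine_tagged_dyadic.
Qed.

Lemma rvH_levy_dyadic_sum Z L : levy P Z -> rvH (dyadic_sum Rs t Z L).
Proof. by move=> [rZ _]; exact: (rvH_dyadic_sum sepH t0 Rlin RM rZ). Qed.

(** * Splitting a Levy process into [n] stretched blocks *)

Section blocks.
Variables (Z : R -> Om -> H) (n : nat).
Hypotheses (LZ : levy P Z) (n0 : (0 < n)%N).

Let nR0 : 0 < n%:R :> R. Proof. by rewrite ltr0n. Qed.

(** A common refinement: every [n]-th point is a dyadic point for [Z], while the [2 ^ L] steps from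
    index [j * 2 ^ L] on are the dyadic grid of block [j]. *)
Definition pt L i : R := dyadic t L i / n%:R.
Definition xi L i (w : Om) : H := Z (pt L i.+1) w - Z (pt L i) w.
Definition block_start j : R := t * j%:R / n%:R.
Definition block j := rescaled Z (block_start j) n%:R^-1.

Lemma pt_ge0 L i : 0 <= pt L i.
Proof. by rewrite divr_ge0// dyadic_ge0. Qed.

Lemma ptS L i : pt L i.+1 - pt L i = t / 2 ^+ L / n%:R.
Proof. by rewrite /pt -mulrBl dyadicS addrAC subrr add0r. Qed.

Lemma pt_lt L i : pt L i < pt L i.+1.
Proof. by rewrite -subr_gt0 ptS !divr_gt0// exprn_gt0. Qed.

Let two0 L : 2 ^+ L != 0 :> R. Proof. by rewrite gt_eqF// exprn_gt0. Qed.

Lemma pt_double L i : pt L.+1 (2 * i) = pt L i.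
Proof.
rewrite /pt /dyadic natrM exprS; congr (_ * _); congr (_ * _).
by rewrite -mulf_div divff ?mul1r// pnatr_eq0.
Qed.

Lemma pt_block L j k : block_start j + dyadic t L k * n%:R^-1 = pt L (j * 2 ^ L + k).
Proof.
rewrite /pt /dyadic /block_start natrD natrM natrX -mulrDl -mulrDr.
by rewrite mulrDl mulfK.
Qed.

Lemma pt_dyadic L k : pt L (k * n) = dyadic t L k.
Proof.
rewrite /pt /dyadic natrM -mulrA; congr (_ * _).
by rewrite mulrAC mulfK// gt_eqF.
Qed.

Lemma block_incr L j k w :
  block j (dyadic t L k.+1) w - block j (dyadic t L k) w = xi L (j * 2 ^ L + k) w.
Proof. by rewrite rescaledB !pt_block addnS. Qed.

Lemma levy_block j : levy P (block j).
Proof. by apply: levy_rescaled => //; rewrite ?invr_gt0// divr_ge0// mulr_ge0// ltW. Qed.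

Lemma xi_rvH L i : rvH (xi L i).
Proof. by have [rZ _] := LZ; apply: rvHB => //; apply: rZ; exact: pt_ge0. Qed.

Lemma xi_indep L a N : indep_family P N (fun i => xi L (a + i)).
Proof.
have [_ [_ iZ _ _ _]] := LZ.
have rS k : (k < N)%N -> pt L (a + k) < pt L (a + k.+1) by rewrite addnS pt_lt.
have := iZ N (fun k => pt L (a + k)) (pt_ge0 _ _) rS.
by under eq_fun do rewrite addnS.
Qed.

Lemma xi_law L i j B : borel_sets B -> P (xi L i @^-1` B) = P (xi L j @^-1` B).
Proof.
move=> mB; have [_ [_ _ sZ _ _]] := LZ.
by rewrite !sZ ?ptS ?pt_ge0// ltW// pt_lt.
Qed.

Lemma sum_xi L a k w : \sum_(i < k) xi L (a + i) w = Z (pt L (a + k)) w - Z (pt L a) w.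
Proof.
elim: k => [|k IH]; first by rewrite big_ord0 addn0 subrr.
by rewrite big_ord_recr /= IH addrC addnS /xi addrA subrK.
Qed.

Definition block_algebra L a b := <<s cyl (xi L) (a * 2 ^ L) (b * 2 ^ L) >>.
(** All levels at once, because the limit of the block sums depends on increments of every level.
    The union is closed under intersection since the algebras grow with [L]. *)
Definition block_generators a b : set (set Om) := \bigcup_L block_algebra L a b.

(** Each increment of one level is the sum of two increments of the next. *)
Lemma block_algebra_sub L L' a b : (L <= L')%N ->
  block_algebra L a b `<=` block_algebra L' a b.
Proof.
elim: L' => [|L' IH]; first by rewrite leqn0 => /eqP ->.
rewrite leq_eqVlt => /predU1P[->//|]; rewrite ltnS => /IH sub.
apply: (subset_trans sub) => {sub IH}.
apply: (@cyl_generated_measurable _ _ _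
  (g_sigma_algebraType (cyl (xi L'.+1) (a * 2 ^ L'.+1) (b * 2 ^ L'.+1)))).
move=> i /andP[ai ib].
have -> : xi L' i = (fun w => xi L'.+1 (2 * i) w + xi L'.+1 (2 * i).+1 w).
  apply/funext => w; rewrite /xi (_ : (2 * i).+2 = 2 * i.+1)%N; last by rewrite mulnS.
  by rewrite !pt_double [RHS]addrC addrA subrK.
have lo : (a * 2 ^ L'.+1 <= 2 * i)%N by rewrite expnS mulnCA leq_mul2l.
have hi : ((2 * i).+1 < b * 2 ^ L'.+1)%N.
  rewrite expnS mulnCA (leq_trans (_ : _ <= 2 * i.+1))%N ?leq_mul2l//.
  by rewrite mulnS.
apply: (@rvHD _ _ _ (g_sigma_algebraType _) sepH) => B mB; apply: cyl_coord => //.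
- by rewrite lo (ltnW hi).
- by rewrite hi (leq_trans lo).
Qed.

Lemma block_algebra_measurable L a b : block_algebra L a b `<=` measurable.
Proof. by apply: cyl_generated_measurable => i _; exact: xi_rvH. Qed.

Lemma block_generators_measurable a b : block_generators a b `<=` measurable.
Proof. by move=> A [L _]; exact: block_algebra_measurable. Qed.

Lemma block_generated_measurable a b : <<s block_generators a b >> `<=` measurable.
Proof.
apply: smallest_sub; first exact: sigma_algebra_measurable.
exact: block_generators_measurable.
Qed.

Lemma block_generators_setI a b : setI_closed (block_generators a b).
Proof.
move=> A B [L _ AL] [L' _ BL]; exists (maxn L L') => //.
by apply: (@measurableI _ (g_sigma_algebraType _)); [
  exact: block_algebra_sub (leq_maxl _ _) _ AL|
  exact: block_algebra_sub (leq_maxr _ _) _ BL].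
Qed.

Lemma block_generators_setT a b : block_generators a b setT.
Proof. by exists 0%N => //; exact: (@measurableT _ (g_sigma_algebraType _)). Qed.

Lemma block_generated_sub a b a' b' : (a' <= a)%N -> (b <= b')%N ->
  <<s block_generators a b >> `<=` <<s block_generators a' b' >>.
Proof.
move=> aa bb; apply: smallest_sub; first exact: smallest_sigma_algebra.
move=> A [L _ AL]; apply: sub_sigma_algebra; exists L => //; move: A AL.
apply: (@cyl_generated_measurable _ _ _
  (g_sigma_algebraType (cyl (xi L) (a' * 2 ^ L) (b' * 2 ^ L)))) => i /andP[ai ib].
move=> B mB; apply: cyl_coord => //.
rewrite (leq_trans _ ai) ?leq_mul2r ?aa ?orbT//=.
by rewrite (leq_trans ib)// leq_mul2r bb orbT.
Qed.

(** Two generating events, possibly of different levels, are moved to the larger level, where they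
    depend on disjoint ranges of independent increments. *)
Lemma blocks_indep a b A B : (a <= b)%N -> <<s block_generators 0 a >> A ->
  <<s block_generators a b >> B -> P (A `&` B) = (P A * P B)%E.
Proof.
move=> ab; move: A B; apply: indep_generated.
- exact: block_generators_measurable.
- exact: block_generators_setI.
- exact: block_generators_setT.
- exact: block_generators_measurable.
- exact: block_generators_setI.
- exact: block_generators_setT.
move=> A B [L _ AL] [L' _ BL].
have iX := @xi_indep (maxn L L') 0 (b * 2 ^ maxn L L').
apply: (@indep_blocks _ _ _ _ P (xi (maxn L L')) (b * 2 ^ maxn L L')
  (a * 2 ^ maxn L L') (b * 2 ^ maxn L L')) => //.
- by move=> i _; exact: xi_rvH.
- by have := block_algebra_sub (leq_maxl L L') AL; rewrite /block_algebra mul0n.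
- exact: block_algebra_sub (leq_maxr L L') _ BL.
- by rewrite leq_mul2r ab orbT.
Qed.

Lemma block_adapted j L k : (k <= 2 ^ L)%N ->
  rv_wrt <<s block_generators j j.+1 >> (block j (dyadic t L k)).
Proof.
move=> kL.
have -> : block j (dyadic t L k) = (fun w => \sum_(i < k) xi L (j * 2 ^ L + i) w).
  apply/funext => w; rewrite sum_xi /block /rescaled pt_block; congr (_ - Z _ w).
  by rewrite -(addn0 (j * 2 ^ L)%N) -pt_block /dyadic mul0r mulr0 mul0r addr0.
move=> B mB; apply: sub_sigma_algebra; exists L => //; move: B mB.
apply: (@rvH_sum _ _ _ (g_sigma_algebraType _) sepH k
  (fun i => xi L (j * 2 ^ L + i))) => i ik B mB.
by apply: cyl_coord => //; rewrite leq_addr /= mulSn addnC ltn_add2r (leq_trans ik).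
Qed.

Lemma block_dyadic_sum j L w : dyadic_sum Rs t (block j) L w =
  \sum_(k < 2 ^ L) psi Rs t (dyadic t L k) (xi L (j * 2 ^ L + k) w).
Proof. by apply: eq_bigr => k _; rewrite block_incr. Qed.

Let pc L k : (k < 2 ^ L)%N -> continuous (psi Rs t (dyadic t L k)).
Proof.
by move=> kL; apply: (psi_continuous Rlin RM); apply: dyadic_range => //; exact: ltnW.
Qed.

Lemma block_sum_law j j' L B : borel_sets B ->
  P (dyadic_sum Rs t (block j) L @^-1` B) = P (dyadic_sum Rs t (block j') L @^-1` B).
Proof.
move=> mB; pose N := (2 ^ L)%N.
have := @indep_family_same_law _ _ _ _ P (fun i => xi L (j * N + i))
  (fun i => xi L (j' * N + i)) N
  (fun x => \sum_(k < N) psi Rs t (dyadic t L k) (x k))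
  (xi_indep _ _ _) (fun i _ => xi_rvH _ _) (xi_indep _ _ _) (fun i _ => xi_rvH _ _)
  (fun i C _ mC => xi_law _ _ _ mC) _ B mB.
have E i : (fun w => \sum_(k < N) psi Rs t (dyadic t L k) (xi L (i * N + k) w)) =
    dyadic_sum Rs t (block i) L.
  by apply/funext => w; rewrite block_dyadic_sum.
rewrite !E; apply.
apply: (@rvH_sum _ _ _ (g_sigma_algebraType _) sepH N
  (fun k (x : nat -> H) => psi Rs t (dyadic t L k) (x k))) => k kN.
apply: (@rvH_comp _ _ _ (g_sigma_algebraType _) _ _ (pc kN)) => C mC.
by apply: (cyl_coord (X := fun i (x : nat -> H) => x i)).
Qed.

(* Both sides distribute the [n * 2 ^ L] exchangeable increments [xi L i] over
   the operators [psi (dyadic t L k)]: in consecutive runs for [Z], with stride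
   [2 ^ L] for the blocks. *)
Lemma total_sum_law L B : borel_sets B ->
  P ((fun w => \sum_(j < n) dyadic_sum Rs t (block j) L w) @^-1` B) =
  P (dyadic_sum Rs t Z L @^-1` B).
Proof.
move=> mB; pose N := (2 ^ L)%N; pose K := (n * N)%N.
have N0 : (0 < N)%N by rewrite expn_gt0.
(* [p] transposes the [n] by [N] array of increments, sending [k * n + j] to [j * N + k]; [p'] is
   its inverse. *)
pose p i := (i %% n * N + i %/ n)%N.
pose p' i := (i %% N * n + i %/ N)%N.
have hp i : (i < K)%N -> (p i < K)%N /\ p' (p i) = i.
  move=> iK; have iN : (i %/ n < N)%N by rewrite ltn_divLR// mulnC.
  have im : (i %% n < n)%N by rewrite ltn_mod.
  split.
    rewrite /p /K (@leq_trans ((i %% n).+1 * N))//; last by rewrite leq_mul2r im orbT.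
    by rewrite mulSn addnC ltn_add2r.
  rewrite /p' /p modnMDl (modn_small iN) divnMDl// (divn_small iN) addn0.
  by rewrite -divn_eq.
have hp' i : (i < K)%N -> (p' i < K)%N /\ p (p' i) = i.
  move=> iK; have iN : (i %/ N < n)%N by rewrite ltn_divLR.
  have im : (i %% N < N)%N by rewrite ltn_mod.
  split.
    rewrite /p' /K (mulnC n N) (@leq_trans ((i %% N).+1 * n))//; last by rewrite leq_mul2r im orbT.
    by rewrite mulSn addnC ltn_add2r.
  rewrite /p' /p modnMDl (modn_small iN) divnMDl// (divn_small iN) addn0.
  by rewrite -divn_eq.
pose g (x : nat -> H) := \sum_(k < N) \sum_(i < n) psi Rs t (dyadic t L k) (x (k * n + i)%N).
have iX := @xi_indep L 0 K.
have iX' : indep_family P K (fun i => xi L (p i)) by exact: indep_family_perm hp hp' iX.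
have := @indep_family_same_law _ _ _ _ P (fun i => xi L (p i)) (xi L) K g
  iX' (fun i _ => xi_rvH _ _) iX (fun i _ => xi_rvH _ _)
  (fun i C _ mC => xi_law _ _ _ mC) _ B mB.
have -> : (fun w => g ((fun i => xi L (p i)) ^~ w)) =
    (fun w => \sum_(j < n) dyadic_sum Rs t (block j) L w).
  apply/funext => w; rewrite /g exchange_big /=; apply: eq_bigr => j _.
  rewrite block_dyadic_sum; apply: eq_bigr => k _.
  have jn := ltn_ord j.
  by rewrite /p modnMDl (modn_small jn) divnMDl// (divn_small jn) addn0.
have -> : (fun w => g (xi L ^~ w)) = dyadic_sum Rs t Z L.
  apply/funext => w; apply: eq_bigr => k _.
  have lk : linear_op (psi Rs t (dyadic t L k)).
    by apply: (psi_linear Rlin); apply: dyadic_range => //; exact: ltnW.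
  (* Linearity merges the [n] consecutive increments under one operator into a single dyadic
     increment of [Z]. *)
  transitivity (psi Rs t (dyadic t L k) (\sum_(i < n) xi L (k * n + i) w)).
    elim/big_rec2: _ => [|i y1 y2 _ ->]; first by rewrite (linear_op0 lk).
    by rewrite [RHS](linear_opD _ _ lk).
  by rewrite sum_xi -mulSnr !pt_dyadic.
apply.
apply: (@rvH_sum _ _ _ (g_sigma_algebraType _) sepH N (fun k (x : nat -> H) =>
  \sum_(i < n) psi Rs t (dyadic t L k) (x (k * n + i)%N))) => k kN.
apply: (@rvH_sum _ _ _ (g_sigma_algebraType _) sepH n (fun i (x : nat -> H) =>
  psi Rs t (dyadic t L k) (x (k * n + i)%N))) => i ni.
apply: (@rvH_comp _ _ _ (g_sigma_algebraType _) _ _ (pc kN)) => C mC.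
apply: (cyl_coord (X := fun i (x : nat -> H) => x i)) => //=.
rewrite /K (mulnC n N) (@leq_trans (k.+1 * n))//; last by rewrite leq_mul2r kN orbT.
by rewrite mulSn addnC ltn_add2r.
Qed.

(** Two descriptions of [X j] are combined: measurability for the increments of block [j] gives
    independence, and being the limit of the block's dyadic sums gives the laws. *)
Lemma block_decomposition Y : rvH Y -> riemann_limit_of Z Y ->
  exists X : nat -> Om -> H, [/\ forall i, rvH (X i), indep_family P n X,
    (forall i j B, borel_sets B -> P (X i @^-1` B) = P (X j @^-1` B)) &
    (forall B, borel_sets B ->
       P ((fun w => \sum_(i < n) X i w) @^-1` B) = P (Y @^-1` B))].
Proof.
move=> rY ZY.
have /choice[X hX] : forall j, exists X, rv_wrt <<s block_generators j j.+1 >> X /\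
    riemann_limit_of (block j) X.
  move=> j; apply: levy_riemann_limit; first exact: levy_block.
  - exact: block_generated_measurable.
  - by move=> L k kL; exact: block_adapted.
have rX j : rvH (X j).
  by move=> B mB; apply: block_generated_measurable; have [r _] := hX j; exact: r.
have cX j : prob_cvg P (dyadic_sum Rs t (block j)) (X j).
  by apply: riemann_limit_dyadic; have [] := hX j.
have rD j L : rvH (dyadic_sum Rs t (block j) L).
  by apply: rvH_levy_dyadic_sum; exact: levy_block.
exists X; split=> //.
- move: n => m B mB; elim: m => [|m IH].
    by rewrite big_ord0 II0 bigcap_set0 probability_setT.
  have -> : \bigcap_(i < m.+1) (X i @^-1` B i) =
      \bigcap_(i < m) (X i @^-1` B i) `&` (X m @^-1` B m).
    apply/seteqP; split=> w.
      by move=> h; split=> [i /= im|]; apply: h => //=; exact: ltnW.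
    move=> [h1 h2] i /=; rewrite ltnS leq_eqVlt => /predU1P[->//|im].
    exact: h1.
  rewrite big_ord_recr /= -IH; apply: (@blocks_indep m m.+1) => //; last first.
    by have [r _] := hX m; exact: r.
  apply: (@fin_bigcap_measurable _ (g_sigma_algebraType (block_generators 0 m))) => //.
  move=> i /= im; have [r _] := hX i.
  by apply: (@block_generated_sub i i.+1 0 m) => //; exact: r.
- move=> i j; apply: (law_limit sepH (rD i) (rD j)) => //.
  by move=> L B mB; exact: block_sum_law.
- apply: (law_limit sepH (X := fun L w => \sum_(j < n) dyadic_sum Rs t (block j) L w)
    (X' := dyadic_sum Rs t Z)) => //.
  + by move=> L; apply: (rvH_sum sepH (F := fun j => dyadic_sum Rs t (block j) L)).
  + by move=> L; exact: rvH_levy_dyadic_sum.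
  + by apply: (rvH_sum sepH (F := X)).
  + by apply: (prob_cvg_sum sepH n (X := fun j => dyadic_sum Rs t (block j)) (Y := X)).
  + exact: riemann_limit_dyadic.
  + by move=> L B mB; exact: total_sum_law.
Qed.

End blocks.
End infinite_divisibility.

(* Reversing time, [r k = t - p (m - k)] and [sg k = t - s (m - k)] turn the
   resolvent sums into Riemann sums of [psi tau = Rs (t - tau)]. *)
Lemma resolvent_step_integral_riemann (R : realType) (H : completeNormedModType R)
    (d : measure_display) (Om : measurableType d) (Rs : R -> H -> H) (t : R) (m : nat)
    (p s : nat -> R) (Z : R -> Om -> H) :
  resolvent_step_integral Rs t m p s Z =
  riemann_sum Rs t Z m (fun k => t - p (m - k)%N) (fun k => t - s (m - k)%N).
Proof.
apply/funext => w; rewrite /resolvent_step_integral /step_integral /riemann_sum.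
by apply: eq_bigr => k _; rewrite /psi subKr.
Qed.

Lemma fine_tagged_reverse (R : realType) (t dl : R) (m : nat) (p s : nat -> R) :
  p 0%N = 0 -> p m = t -> (forall i, (i < m)%N -> p i < p i.+1) ->
  (forall i, (0 < i)%N -> (i <= m)%N -> p i.-1 <= s i <= p i) -> mesh m p <= dl ->
  fine_tagged t m (fun k => t - p (m - k)%N) (fun k => t - s (m - k)%N) dl.
Proof.
move=> p0 pm pS sP hmesh.
have subS k : (k < m)%N -> (m - k = (m - k.+1).+1)%N by move=> km; rewrite subnSK.
have lt_m k : (k < m)%N -> (m - k.+1 < m)%N.
  by move=> km; rewrite -subS// leq_subr.
split.
- by rewrite subn0 pm subrr.
- by rewrite subnn p0 subr0.
- by move=> k km; rewrite (subS k km) ltrD2l ltrN2; apply: pS; exact: lt_m.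
- move=> k km; have := sP (m - k)%N; rewrite (subS k km) /= => /(_ isT (lt_m k km)).
  by move=> /andP[h1 h2]; rewrite !lerD2l !lerN2 h1 h2.
- move=> k km; rewrite (subS k km).
  have -> : t - p (m - k.+1)%N - (t - p (m - k.+1).+1) =
      p (m - k.+1).+1 - p (m - k.+1)%N by ring.
  rewrite (le_trans _ hmesh)// /mesh.
  exact: (le_bigmax _ (fun i : 'I_m => p i.+1 - p i) (Ordinal (lt_m k km))).
Qed.

Theorem theorem3 (R : realType) (H : completeNormedModType R) (ip : H -> H -> R)
    (D : set H) (A : H -> H) (a : R -> R) (Rs : R -> H -> H)
    (d : measure_display) (Om : measurableType d) (P : probability Om R)
    (F : R -> set (set Om)) (Z : R -> Om -> H) (t : R) :
  sep_hilbert ip ->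
  closed_dense_op D A ->
  loc_integrable_Rplus a ->
  resolvent_family ip D A a Rs ->
  filtration F ->
  levy_process P F Z ->
  0 < t ->
  exists Y : Om -> H,
    [/\ rvH Y,
        inf_divisible P Y &
        forall (m : nat -> nat) (p s : nat -> nat -> R),
          tagged_partitions t m p s ->
          cvg_in_prob P
            (fun n w => resolvent_step_integral Rs t (m n) (p n) (s n) Z w) Y].
Proof.
move=> [ipH sepH] _ _ [Rb [RT Rcont _ _ _]] filF LF t0.
have LZ := levy_process_levy filF LF.
have [rZ _] := LZ.
have [M hM] := RT t.
have Rlin s : 0 <= s <= t -> linear_op (Rs s).
  by move=> /andP[s0 _]; have [] := Rb s s0.
have RM s x : 0 <= s <= t -> `|Rs s x| <= M * `|x| by move=> hs; exact: hM.
have [||Y [rY ZY]] := levy_riemann_limit ipH sepH t0 Rlin RM Rcont (G := measurable) LZ.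
- by apply: smallest_sub => //; exact: sigma_algebra_measurable.
- move=> L k _ B mB; apply: sub_sigma_algebra; apply: rZ => //; exact: dyadic_ge0.
have {}rY : rvH Y.
  move=> B /rY; apply: smallest_sub => //; exact: sigma_algebra_measurable.
exists Y; split=> //.
(* The [n] summands are found on the original probability space, as limits for the blocks of [Z]. *)
- move=> n n0; exists d, Om, P.
  have [X [rX iX sX tX]] :=
    block_decomposition ipH sepH t0 Rlin RM Rcont LZ n0 rY ZY.
  by exists X; split=> // i j B _ _; exact: sX.
move=> m p s [pe pS sP hmesh] eps eps0.
have ft n dl : mesh (m n) (p n) <= dl -> fine_tagged t (m n)
    (fun k => t - p n (m n - k)%N) (fun k => t - s n (m n - k)%N) dl.
  have [p0 pm] := pe n.
  by apply: fine_tagged_reverse => //; [exact: pS|exact: sP].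
have rS n : rvH (resolvent_step_integral Rs t (m n) (p n) (s n) Z).
  rewrite resolvent_step_integral_riemann.
  exact: (rvH_riemann_sum sepH Rlin RM rZ (ft n _ (lexx _))).
have mS n := measurable_far sepH eps (rS n) rY.
apply/fine_cvgP; split; first by apply: nearW => n; rewrite fin_num_measure.
apply/cvgrPdist_le => eta eta0.
(* The Ky Fan bound at [e] controls the distance by [eps] and the probability by [eta] at once. *)
pose e := Num.min eps eta.
have e0 : 0 < e by rewrite lt_min eps0.
have [dl [dl0 hdl]] := ZY e e0.
move/cvgrPdist_le : hmesh => /(_ dl dl0); apply: filterS => n.
rewrite sub0r normrN => /(le_trans (ler_norm _)) hn.
have := hdl _ _ _ (ft n dl hn).
rewrite -resolvent_step_integral_riemann => far_e.
rewrite /= sub0r normrN ger0_norm ?fine_prob_ge0//.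
apply: (@le_trans _ _ e); last by rewrite ge_min lexx orbT.
apply: le_trans far_e; apply: (far_le sepH P (rS n) rY).
by rewrite ge_min lexx.
Qed.
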